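(* Let $(X_n)_{n\in\mathbb{N}}$ be a Markov chain with transition kernel $K$ and initial distribution $\nu$. Let $K$ be reversible with respect to $\pi$ and $L_1$-exponentially convergent with $(\alpha,M)$, where $\alpha\in[0,1)$ and $M<\infty$. Let $f\in L_2$ and assume that the probability measure $\nu$ belongs to $\mathcal{M}_\infty$. Then $$e_\nu(S_{n,n_0},f)^2 \leq \frac{2}{n(1-\Lambda)}\|f\|_{2}^2 +\frac{ 2M \left\|\frac{d\nu}{d\pi}-1\right\|_{\infty} \alpha^{n_0} }{n^2 (1-\alpha)^2}\|f\|_{2}^2,$$ and for $g=f-S(f)$ we have $$\lim_{n\to \infty} n\cdot e_\nu(S_{n,n_0},f)^2 =\lim_{n\to \infty} n\cdot e_\pi(S_{n},f)^2 =\langle (I+P)(I-P)^{-1}g,g\rangle .$$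
   Context: $\mathbb{N}=\{1,2,\dots\}$; $n\in\mathbb{N}$ is the sample size and $n_0\in\mathbb{N}\cup\{0\}$ the burn-in (fixed in the limits). $(D,\mathcal{D})$ is a measurable space, $K$ a transition (Markov) kernel on it, $\pi$ a probability measure. $K$ is reversible with respect to $\pi$ if $\int_B K(x,A)\pi(dx)=\int_A K(x,B)\pi(dx)$ for all $A,B\in\mathcal{D}$; then $\pi$ is stationary. A Markov chain $(X_n)_{n\in\mathbb{N}}$ with kernel $K$ and initial distribution $\nu$ satisfies $X_1\sim\nu$ and $\Pr(X_{n+1}\in A\mid X_1,\dots,X_n)=K(X_n,A)$ a.s. $L_p=L_p(D,\pi)$ is the real $L_p$-space with norm $\|\cdot\|_p$; $\langle f,g\rangle=\int_D fg\,d\pi$; $S(f)=\int_D f\,d\pi$ (also viewed as an operator into constant functions); $Pf(x)=\int_D f(y)K(x,dy)$; $I$ is the identity; $L_2^0=\{f\in L_2: S(f)=0\}$, on which $P$ is self-adjoint, and $\Lambda=\sup\{a: a\in\mathrm{spec}(P|L_2^0)\}$, where $\mathrm{spec}(P|L_2^0)$ is the spectrum of $P:L_2^0\to L_2^0$. $(I-P)^{-1}$ is the inverse on $L_2^0$. $K$ is $L_1$-exponentially convergent with $(\alpha,M)$ if $\|P^n-S\|_{L_1\to L_1}\le M\alpha^n$ for all $n\in\mathbb{N}$. $\nu\in\mathcal{M}_\infty$ means that $\nu$ has a $\pi$-essentially bounded density $\frac{d\nu}{d\pi}$ with respect to $\pi$. $S_{n,n_0}(f)=\frac1n\sum_{j=1}^n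 f(X_{j+n_0})$, $S_n=S_{n,0}$, and $e_\nu(S_{n,n_0},f)=\big(\mathbf{E}_{\nu,K}|S_{n,n_0}(f)-S(f)|^2\big)^{1/2}$, where $\mathbf{E}_{\nu,K}$ is the expectation for the chain with kernel $K$ and initial distribution $\nu$; $e_\pi$ is the error when the initial distribution is $\pi$.
   Formalization: For burn-in n_0 = 0 the error estimate is stated under the additional assumption M ≥ 1; without it the estimate fails (e.g. K(x,·)=π, α=M=0, n=1); for n_0 ≥ 1 and for the limits nothing is added. *)

(* Defs.v *)
From HB Require Import structures.
From mathcomp Require Import all_boot all_order all_algebra.
From mathcomp Require Import all_classical all_reals all_analysis.
From mathcomp Require Import measurable_realfun.

Set Implicit Arguments.
Unset Strict Implicit.
Unset Printing Implicit Defensive.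

Import Order.TTheory GRing.Theory Num.Theory.
Import numFieldNormedType.Exports.

Local Open Scope classical_set_scope.
Local Open Scope ring_scope.

(* Elements of L_p(D, pi) are represented by functions D -> R belonging to
   [Lfun pi p]; equalities between them are pi-almost everywhere. *)

Definition reversible {R : realType} {d : measure_display}
    {D : measurableType d} (K : R.-pker D ~> D) (pi : probability D R) : Prop :=
  forall A B : set D, measurable A -> measurable B ->
    (\int[pi]_(x in B) K x A = \int[pi]_(x in A) K x B)%E.

(* For h in L_1(pi) with pi stationary, h is K(x, .)-integrable for pi-almost
   every x only; the value at the remaining x is irrelevant. *)
Definition transition_op {R : realType} {d : measure_display}
    {D : measurableType d} (K : R.-pker D ~> D) (h : D -> R) : D -> R :=
  fun x => \int[K x]_y h y.

Definition mean {R : realType} {d : measure_display} {D : measurableType d}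
    (pi : probability D R) (h : D -> R) : R := \int[pi]_x h x.

Definition inner {R : realType} {d : measure_display} {D : measurableType d}
    (pi : probability D R) (g h : D -> R) : R := \int[pi]_x (g x * h x).

Definition opnorm {R : realType} {d : measure_display} {D : measurableType d}
    (pi : probability D R) (p : \bar R) (A : (D -> R) -> (D -> R)) : \bar R :=
  ereal_sup [set 'N[pi]_p[EFin \o A h]%E | h in
    [set h : D -> R | h \in Lfun pi p /\ ('N[pi]_p[EFin \o h] <= 1)%E]].

Definition L1_exp_convergent {R : realType} {d : measure_display}
    {D : measurableType d} (K : R.-pker D ~> D) (pi : probability D R)
    (alpha M : R) : Prop :=
  forall n : nat, (0 < n)%N ->
    (opnorm pi 1 (fun h x => (iter n (transition_op K) h x - mean pi h)%R)
      <= (M * alpha ^+ n)%:E)%E.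

Definition L20 {R : realType} {d : measure_display} {D : measurableType d}
    (pi : probability D R) : set (D -> R) :=
  [set h | h \in Lfun pi 2%:E /\ mean pi h = 0].

(* B is a bounded two-sided inverse of the operator A on the subspace W of
   L_2(pi). When A is linear, the boundedness and the two inverse laws force B
   to be compatible with a.e. equality and linear up to a.e. equality, so these
   two properties are not required separately. *)
Definition is_bounded_inverse {R : realType} {d : measure_display}
    {D : measurableType d} (pi : probability D R) (W : set (D -> R))
    (A B : (D -> R) -> (D -> R)) : Prop :=
  [/\ forall h, W h -> W (B h),
      exists C : R, forall h, W h ->
        ('N[pi]_2%:E[EFin \o B h] <= C%:E * 'N[pi]_2%:E[EFin \o h])%E,
      forall h, W h -> A (B h) = h %[ae pi]
    & forall h, W h -> B (A h) = h %[ae pi] ].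

Definition spectrum {R : realType} {d : measure_display} {D : measurableType d}
    (pi : probability D R) (W : set (D -> R)) (A : (D -> R) -> (D -> R)) :
    set R :=
  [set a | ~ exists B, is_bounded_inverse pi W (fun h x => a * h x - A h x) B].

(* If L_2^0 is trivial then the spectrum is empty, and [sup set0 = 0]. *)
Definition Lambda {R : realType} {d : measure_display} {D : measurableType d}
    (K : R.-pker D ~> D) (pi : probability D R) : R :=
  sup (spectrum pi (L20 pi) (transition_op K)).

Definition density {R : realType} {d : measure_display} {D : measurableType d}
    (nu pi : probability D R) : D -> \bar R :=
  Radon_Nikodym (charge_of_finite_measure nu) pi.

Definition M_infty {R : realType} {d : measure_display} {D : measurableType d}
    (pi nu : probability D R) : Prop :=
  nu `<< pi /\ ('N[pi]_+oo[density nu pi] < +oo)%E.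

(* Y is a version of the conditional probability of E given the
   sigma-algebra G. *)
Definition is_cond_prob {R : realType} {d : measure_display}
    {O : measurableType d} (P : probability O R) (G : set (set O)) (E : set O)
    (Y : O -> \bar R) : Prop :=
  (forall B : set (\bar R), measurable B -> G (Y @^-1` B)) /\
  (forall F : set O, G F -> (\int[P]_(w in F) Y w = P (E `&` F))%E).

(* sigma(X_1, ..., X_n) *)
Definition history {d d' : measure_display} {D : measurableType d}
    {O : measurableType d'} (X : nat -> {mfun O >-> D}) (n : nat) :
    set (set O) :=
  <<s \bigcup_(i in [set i : nat | (1 <= i <= n)%N])
        preimage_set_system setT (X i) measurable >>.

(* The chain is X 1, X 2, ...; the variable X 0 is never used. *)
Definition markov_chain {R : realType} {d d' : measure_display}
    {D : measurableType d} {O : measurableType d'} (P : probability O R)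
    (X : nat -> {mfun O >-> D}) (K : R.-pker D ~> D) (nu : probability D R) :
    Prop :=
  (forall A : set D, measurable A -> P (X 1%N @^-1` A) = nu A) /\
  (forall (n : nat) (A : set D), (0 < n)%N -> measurable A ->
    is_cond_prob P (history X n) (X n.+1 @^-1` A) (fun w => K (X n w) A)).

Definition sample_mean {R : realType} {d d' : measure_display}
    {D : measurableType d} {O : measurableType d'} (X : nat -> {mfun O >-> D})
    (n n0 : nat) (f : D -> R) : O -> R :=
  fun w => n%:R^-1 * \sum_(1 <= j < n.+1) f (X (j + n0)%N w).

Definition mc_error {R : realType} {d d' : measure_display}
    {D : measurableType d} {O : measurableType d'} (P : probability O R)
    (X : nat -> {mfun O >-> D}) (pi : probability D R) (n n0 : nat)
    (f : D -> R) : \bar R :=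
  ('E_P[fun w => (`|sample_mean X n n0 f w - mean pi f| ^+ 2)%R] `^ 2^-1)%E.

(* Main.v *)
Require Import Defs.
From HB Require Import structures.
From mathcomp Require Import all_boot all_order all_algebra.
From mathcomp Require Import all_classical all_reals all_analysis.
From mathcomp Require Import measurable_realfun ess_sup_inf.
From mathcomp Require Import ring lra.

Set Implicit Arguments.
Unset Strict Implicit.
Unset Printing Implicit Defensive.

Import Order.TTheory GRing.Theory Num.Theory.
Import numFieldNormedType.Exports.

Local Open Scope classical_set_scope.
Local Open Scope ring_scope.

(* On L_2^0 the operator P is symmetric and, for bounded h,
   |P^n h|_2^2 = <h, P^2n h> <= |h|_oo |P^2n h|_1 <= |h|_oo M alpha^2n |h|_1.
   Since n |-> |P^n h|_2^2 is log-convex, its first ratio is at most alpha^2;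
   bounded functions being dense, P contracts L_2^0 by alpha. Hence a - P is
   invertible for a > alpha (Neumann series), Lambda <= alpha, and
   <P h, h> <= Lambda |h|^2 because the supremum of the numerical range of P
   belongs to the spectrum.

   With u = (I - P)^-1 g and c_k = <P^k u, u>, the stationary variance of
   g(X_1) + ... + g(X_n) is n (c_0 - c_2) - 2 (c_1 - c_(n+1)). It is at most
   2 n (c_0 - c_1) = 2 n <u, g> <= 2 n |g|^2 / (1 - Lambda), and after division
   by n it tends to c_0 - c_2 = <(I + P) u, g>.

   For an initial distribution nu the covariance of g(X_i) and g(X_(i+k)) is the
   nu-integral of P^(i-1) (g P^k g), which differs from the stationary one by at
   most M |dnu/dpi - 1|_oo alpha^(i-1+k) |g|^2. Summation gives the second term
   of the bound. *)

(** The hypotheses concern sets: reversibility, the Markov property and the domination of [nu] by a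
    multiple of [pi] compare measures of sets, while the argument needs products of L_2 functions.
    The passage from pairs of sets to pairs of functions is made once, for pairs of kernels;
    self-adjointness of P and the Markov property for functions are two instances of it.

    Bounded functions come first because decay is only available in L_1: |P^2n h|_1 can be paired
    with h only if h is bounded. The factors M and |h|_oo disappear in the passage to the first
    ratio, so the contraction constant is uniform in h and survives the density argument.

    The convergence hypothesis starts at n = 1. Without burn-in the first variable has had no step
    in which to approach [pi], and the bound for P^0 has to come from 1 <= M; for the limit M may be
    enlarged freely. *)

Section nonnegative_functions.
Local Open Scope ereal_scope.
Import HBNNSimple.

(** Approximation from below by simple functions, each a finite sum of scaled indicators. The
    clauses carry measurability and nonnegativity because additivity of the integral asks for both
    wherever the induction is used. *)
Lemma ge0_measurable_fun_ind (R : realType) d (T : measurableType d)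
    (Phi : (T -> \bar R) -> Prop) :
  (forall A, measurable A -> Phi (fun x => (\1_A x)%:E)) ->
  (forall r f, (0 <= r)%R -> measurable_fun setT f -> (forall x, 0 <= f x) ->
    Phi f -> Phi (fun x => r%:E * f x)) ->
  (forall f g, measurable_fun setT f -> (forall x, 0 <= f x) ->
    measurable_fun setT g -> (forall x, 0 <= g x) ->
    Phi f -> Phi g -> Phi (fun x => f x + g x)) ->
  (forall F : (T -> \bar R)^nat, (forall n, measurable_fun setT (F n)) ->
    (forall n x, 0 <= F n x) -> (forall x, nondecreasing_seq (F ^~ x)) ->
    (forall n, Phi (F n)) -> Phi (fun x => limn (F ^~ x))) ->
  forall f, measurable_fun setT f -> (forall x, 0 <= f x) -> Phi f.
Proof.
move=> Hind Hscale Hadd Hlim f mf f0.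
pose f_ := nnsfun_approx measurableT mf.
have -> : f = (fun x => limn (fun n => (f_ n x)%:E)).
  by apply/funext => x; apply/esym/cvg_lim => //; exact: cvg_nnsfun_approx.
apply: Hlim.
- by move=> n; exact/measurable_EFinP.
- by move=> n x; rewrite lee_fin.
- by move=> x a b ab; rewrite lee_fin; exact/lefP/nd_nnsfun_approx.
move=> n; move: (f_ n) => h.
have -> : (fun x => (h x)%:E) = (fun x => \sum_(y <- finmap.enum_fset (fset_set (range h)))
    (y%:E * (\1_(h @^-1` [set y]) x)%:E)).
  apply/funext => x /=; rewrite fimfunE fsbig_finite//=.
  by rewrite -sumEFin; apply: eq_bigr => y _; rewrite EFinM.
have Phi0 : Phi (fun=> 0).
  have := Hind set0 measurable0.
  by congr Phi; apply/funext => x; rewrite indic0.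
(* [Hadd] needs measurable nonnegative summands, so the induction over the finite sum carries these
   two facts along with [Phi]. *)
suff [] : [/\ Phi (fun x => \sum_(y <- finmap.enum_fset (fset_set (range h)))
      (y%:E * (\1_(h @^-1` [set y]) x)%:E)),
    measurable_fun setT (fun x => \sum_(y <- finmap.enum_fset (fset_set (range h)))
      (y%:E * (\1_(h @^-1` [set y]) x)%:E)) &
    forall x, 0 <= \sum_(y <- finmap.enum_fset (fset_set (range h)))
      (y%:E * (\1_(h @^-1` [set y]) x)%:E)] by [].
have mset y : measurable (h @^-1` [set y]) by [].
have pos y x : 0 <= y%:E * (\1_(h @^-1` [set y]) x)%:E.
  rewrite indicE; case: (boolP (x \in _)) => [|_]; last by rewrite mule0.
  by rewrite inE mule1 /= => <-; rewrite lee_fin.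
have meas y : measurable_fun setT
    (fun x => y%:E * (\1_(h @^-1` [set y]) x)%:E).
  by apply: measurable_funeM; exact/measurable_EFinP.
elim: (finmap.enum_fset _) => [|y s [IH1 IH2 IH3]].
  split.
  - by move: Phi0; congr Phi; apply/funext => x; rewrite big_nil.
  - by under eq_fun do rewrite big_nil; exact: measurable_cst.
  - by move=> x; rewrite big_nil.
have E : (fun x => \sum_(i <- y :: s) (i%:E * (\1_(h @^-1` [set i]) x)%:E)) =
   (fun x => y%:E * (\1_(h @^-1` [set y]) x)%:E +
     \sum_(i <- s) (i%:E * (\1_(h @^-1` [set i]) x)%:E)).
  by apply/funext => x; rewrite big_cons.
split.
- rewrite E; apply: Hadd => //.
  (* The list no longer remembers that its entries are values of [h]. For y < 0 the preimage is
     empty and the term vanishes. *)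
  have [y0|y0] := leP 0%R y.
    by apply: Hscale => //; [exact/measurable_EFinP|exact: Hind].
  move: Phi0; congr Phi; apply/funext => x.
  by rewrite preimage_nnfun0// indic0 mule0.
- by rewrite E; exact: emeasurable_funD.
- by move=> x; rewrite big_cons adde_ge0.
Qed.

(** The weights make a second use possible: with [w] first the mass of a set under another kernel,
    then the integral of a function against that kernel, two applications turn an identity for pairs
    of sets into one for products of functions. *)
Lemma weighted_integral_kernel_eq (R : realType) d d' d'' (T : measurableType d)
    (T' : measurableType d') (Y : measurableType d'')
    (m : {measure set T -> \bar R}) (m' : {measure set T' -> \bar R})
    (k : T -> {measure set Y -> \bar R}) (k' : T' -> {measure set Y -> \bar R})
    (w : T -> \bar R) (w' : T' -> \bar R) :
  (forall U, measurable U -> measurable_fun setT (k ^~ U)) ->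
  (forall U, measurable U -> measurable_fun setT (k' ^~ U)) ->
  measurable_fun setT w -> measurable_fun setT w' ->
  (forall x, 0 <= w x) -> (forall x, 0 <= w' x) ->
  (forall U, measurable U ->
    \int[m]_x (w x * k x U) = \int[m']_x (w' x * k' x U)) ->
  forall f, measurable_fun setT f -> (forall y, 0 <= f y) ->
  \int[m]_x (w x * \int[k x]_y f y) = \int[m']_x (w' x * \int[k' x]_y f y).
Proof.
move=> mk mk' mw mw' w0 w'0 kk'.
have mI dT (S : measurableType dT) (l : S -> {measure set Y -> \bar R}) v g :
    (forall U, measurable U -> measurable_fun setT (l ^~ U)) ->
    measurable_fun setT v ->
    measurable_fun setT g -> (forall y, 0 <= g y) ->
    measurable_fun setT (fun x => v x * \int[l x]_y g y).
  by move=> ml mv mg g0; apply: emeasurable_funM => //;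
    exact: measurable_fun_integral_kernel.
apply: ge0_measurable_fun_ind.
- move=> A mA.
  under eq_integral do rewrite integral_indic// setIT.
  under [RHS]eq_integral do rewrite integral_indic// setIT.
  exact: kk'.
- move=> r f r0 mf f0 IH.
  under eq_integral do rewrite ge0_integralZl_EFin// muleCA.
  under [RHS]eq_integral do rewrite ge0_integralZl_EFin// muleCA.
  rewrite !ge0_integralZl_EFin ?IH//; try exact: mI.
  + by move=> x _; rewrite mule_ge0// integral_ge0.
  + by move=> x _; rewrite mule_ge0// integral_ge0.
- move=> f g mf f0 mg g0 IHf IHg.
  have D (S : Type) (l : S -> {measure set Y -> \bar R}) v x : 0 <= v x ->
      v x * \int[l x]_y (f y + g y) =
      v x * \int[l x]_y f y + v x * \int[l x]_y g y.
    by move=> v0; rewrite ge0_integralD// ge0_muleDr// integral_ge0.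
  under eq_integral do rewrite D//.
  under [RHS]eq_integral do rewrite D//.
  rewrite !ge0_integralD// ?IHf ?IHg//; try exact: mI;
    by move=> x _; rewrite mule_ge0// integral_ge0.
- move=> F mF F0 ndF IH.
  have lim_int (dT : measure_display) (S : measurableType dT)
      (mu : {measure set S -> \bar R}) (l : S -> {measure set Y -> \bar R}) v :
      (forall U, measurable U -> measurable_fun setT (l ^~ U)) ->
      measurable_fun setT v -> (forall x, 0 <= v x) ->
      \int[mu]_x (v x * \int[l x]_y limn (F ^~ y)) =
      limn (fun n => \int[mu]_x (v x * \int[l x]_y F n y)).
    move=> ml mv v0.
    have ndI x : nondecreasing_seq (fun n => \int[l x]_y F n y).
      by move=> a b ab; apply: ge0_le_integral => // y _; exact: ndF.
    under eq_integral.
      move=> x _; rewrite monotone_convergence//.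
      have -> : v x * limn (fun n => \int[l x]_y F n y) =
          limn (fun n => v x * \int[l x]_y F n y).
        have [vfin|] := boolP (v x \is a fin_num).
          by rewrite limeMl//; exact: ereal_nondecreasing_is_cvgn.
        (* Multiplication by +oo is not continuous at 0, so an infinite weight is treated apart:
           either all integrals vanish, or one is positive and, by monotonicity, both sides are
           +oo. *)
        rewrite ge0_fin_numE// -leNgt leye_eq => /eqP ->.
        have I0 n : 0 <= \int[l x]_y F n y by exact: integral_ge0.
        have [a0|/existsNP[N /eqP aN]] := pselect (forall n, \int[l x]_y F n y = 0).
          by under eq_fun do rewrite a0; rewrite lim_cst// mule0;
            under eq_fun do rewrite a0 mule0; rewrite lim_cst.
        have ndyI : nondecreasing_seq (fun n => +oo * \int[l x]_y F n y).
          by move=> a b ab; apply: lee_wpmul2l => //; exact: ndI.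
        have aN0 : 0 < \int[l x]_y F N y by rewrite lt0e aN I0.
        rewrite gt0_mulye; last first.
          apply: (lt_le_trans aN0); have /cvg_lim -> // := ereal_nondecreasing_cvgn (ndI x).
          by apply: ereal_sup_ubound; exists N.
        apply/esym/eqP; rewrite -leye_eq.
        have /cvg_lim -> // := ereal_nondecreasing_cvgn ndyI.
        by apply: ereal_sup_ubound; exists N => //; rewrite gt0_mulye.
      over.
    rewrite monotone_convergence//.
    + by move=> n; exact: mI.
    + by move=> n x _; rewrite mule_ge0// integral_ge0.
    + by move=> x _ a b ab; apply: lee_wpmul2l => //; exact: ndI.
  rewrite !lim_int//; congr (limn _); apply/funext => n; exact: IH.
Qed.

End nonnegative_functions.

(** * Square-integrable functions *)

Local Notation "m .-L1" := (fun h => m.-integrable setT (EFin \o h))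
  (at level 2, format "m .-L1").
Local Notation "m .-L2" := (fun h => is_true (h \in Lfun m 2%:E))
  (at level 2, format "m .-L2").

Section square_integrable.
Context d (T : measurableType d) (R : realType) (mu : probability T R).
Implicit Types f g h : T -> R.

Lemma L1_measurable h : mu.-L1 h -> measurable_fun setT h.
Proof. by move=> /integrableP[/measurable_EFinP]. Qed.

Lemma L1_cst c : mu.-L1 (cst c).
Proof. exact: finite_measure_integrable_cst. Qed.

Lemma L1_lin a f g : mu.-L1 f -> mu.-L1 g -> mu.-L1 (fun x => a * f x + g x).
Proof.
move=> f1 g1; have := integrableD measurableT (integrableZl measurableT a f1) g1.
by apply: eq_integrable => // x _ /=; rewrite EFinD EFinM.
Qed.

Lemma L1_norm f : mu.-L1 f -> mu.-L1 (fun x => `|f x|).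
Proof. exact: integrable_norm. Qed.

Lemma le_L1 f g : measurable_fun setT f -> (forall x, `|f x| <= g x) ->
  mu.-L1 g -> mu.-L1 f.
Proof.
move=> mf fg; apply: le_integrable => //; first exact/measurable_EFinP.
by move=> x _ /=; rewrite lee_fin (le_trans (fg x))// ler_norm.
Qed.

Lemma mean_lin a f g : mu.-L1 f -> mu.-L1 g ->
  mean mu (fun x => a * f x + g x) = a * mean mu f + mean mu g.
Proof.
move=> f1 g1; rewrite /mean RintegralD//; first by rewrite RintegralZl.
by have := integrableZl measurableT a f1; apply: eq_integrable => // x _ /=; rewrite EFinM.
Qed.

Lemma mean_ge0 f : (forall x, 0 <= f x) -> 0 <= mean mu f.
Proof. by move=> f0; apply: Rintegral_ge0. Qed.

Lemma mean_cst c : mean mu (cst c) = c.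
Proof. 
rewrite /mean Rintegral_cst// -[RHS]mulr1; congr (_ * _).
by transitivity (fine (1%E : \bar R)) => //; congr fine; exact: probability_setT.
Qed.

Lemma le_mean f g : mu.-L1 f -> mu.-L1 g -> (forall x, f x <= g x) ->
  mean mu f <= mean mu g.
Proof. by move=> *; apply: le_Rintegral. Qed.

Lemma normr_mean_le f : mu.-L1 f -> `|mean mu f| <= mean mu (fun x => `|f x|).
Proof. exact: le_normr_Rintegral. Qed.

Lemma EFin_mean f : mu.-L1 f -> (mean mu f)%:E = (\int[mu]_x (f x)%:E)%E.
Proof. by move=> f1; rewrite fineK//; exact: integrable_fin_num. Qed.

Lemma ae_eq_mean f g : mu.-L1 f -> mu.-L1 g -> f = g %[ae mu] ->
  mean mu f = mean mu g.
Proof.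
move=> f1 g1 fg; congr fine; apply: ae_eq_integral => //.
- exact: measurable_int f1.
- exact: measurable_int g1.
- by apply: filterS fg => x /= + _ => /(_ I) ->.
Qed.

Lemma mean_norm_eq0 f : mu.-L1 f -> mean mu (fun x => `|f x|) = 0 ->
  f = cst 0 %[ae mu].
Proof.
move=> f1 f0.
have : ae_eq mu setT (EFin \o f) (cst 0%E).
  apply/ae_eq_integral_abs => //; first exact: measurable_int f1.
  by have := EFin_mean (L1_norm f1); rewrite f0 => <-.
by apply: filterS => x /= /[apply] -[].
Qed.

Lemma L2P h : mu.-L2 h <-> measurable_fun setT h /\ mu.-L1 (fun x => h x ^+ 2).
Proof.
split=> [h2|[mh h2]].
  split; last exact: Lfun2_integrable_sqr.
  by have /andP[] := h2; rewrite inE.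
apply/andP; split; rewrite inE//= /finite_norm unlock poweR_lty//.
apply: le_lt_trans (integrable_lty measurableT h2).
by under eq_integral do rewrite /= powR_mulrn// real_normK ?num_real//.
Qed.

Lemma L2_measurable h : mu.-L2 h -> measurable_fun setT h.
Proof. by move=> /L2P[]. Qed.

Lemma L2_mul f g : mu.-L2 f -> mu.-L2 g -> mu.-L1 (fun x => f x * g x).
Proof. by move=> f2 g2; apply/Lfun1_integrable; exact: Lfun2_mul_Lfun1. Qed.

Lemma L2_L1 h : mu.-L2 h -> mu.-L1 h.
Proof.
move=> h2; apply/Lfun1_integrable; apply: Lfun_subset12 h2.
exact: fin_num_measure.
Qed.

Lemma L2_lin a f g : mu.-L2 f -> mu.-L2 g -> mu.-L2 (fun x => a * f x + g x).
Proof.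
move=> f2 g2; have [mf ff] := (L2P f).1 f2; have [mg gg] := (L2P g).1 g2.
apply/L2P; split; first by apply: measurable_funD => //; exact: measurable_funM.
have := L1_lin (a ^+ 2) ff (L1_lin (a *+ 2) (L2_mul f2 g2) gg).
by apply: eq_integrable => // x _ /=; congr EFin; ring.
Qed.

Lemma L2_cst c : mu.-L2 (cst c).
Proof. exact: Lfun_cst. Qed.

Lemma le_L2 f g : measurable_fun setT f -> (forall x, `|f x| <= `|g x|) ->
  mu.-L2 g -> mu.-L2 f.
Proof.
move=> mf fg /L2P[mg g2]; apply/L2P; split => //.
apply: le_L1 g2; first exact: measurable_funX.
by move=> x; rewrite normrX -[leRHS]real_normK ?num_real// lerXn2r ?nnegrE.
Qed.

Lemma inner_lin a f g h : mu.-L2 f -> mu.-L2 g -> mu.-L2 h ->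
  inner mu (fun x => a * f x + g x) h = a * inner mu f h + inner mu g h.
Proof.
move=> f2 g2 h2; rewrite /inner -/(mean mu (fun x => f x * h x)).
rewrite -/(mean mu (fun x => g x * h x)) -mean_lin//; try exact: L2_mul.
by congr mean; apply/funext => x; ring.
Qed.

Lemma innerC f g : inner mu f g = inner mu g f.
Proof. by congr mean; apply/funext => x; rewrite mulrC. Qed.

Lemma inner_ge0 f : 0 <= inner mu f f.
Proof. by apply: mean_ge0 => x; rewrite -expr2 sqr_ge0. Qed.

Lemma inner_cst1 f : inner mu f (cst 1) = mean mu f.
Proof. by congr mean; apply/funext => x; rewrite mulr1. Qed.

Lemma ae_eq_inner f g h : mu.-L2 f -> mu.-L2 g -> mu.-L2 h ->
  f = g %[ae mu] -> inner mu f h = inner mu g h.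
Proof.
move=> f2 g2 h2 fg; apply: ae_eq_mean; try exact: L2_mul.
by apply: filterS fg => x /= /[apply] ->.
Qed.

Lemma inner_eq0 f : mu.-L2 f -> inner mu f f = 0 -> f = cst 0 %[ae mu].
Proof.
move=> f2 f0; have : (fun x => f x * f x) = cst 0 %[ae mu].
  apply: mean_norm_eq0; first exact: L2_mul.
  by rewrite -[RHS]f0; congr mean; apply/funext => x; rewrite -expr2 normrX real_normK ?num_real.
by apply: filterS => x /= /[apply] /eqP; rewrite mulf_eq0 orbb => /eqP.
Qed.

Lemma Lnorm2_inner h : mu.-L2 h ->
  ('N[mu]_2%:E[EFin \o h] = (Num.sqrt (inner mu h h))%:E)%E.
Proof.
move=> h2; rewrite unlock.
have -> : (\int[mu]_x (`|(EFin \o h) x| `^ 2) = (inner mu h h)%:E)%E.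
  rewrite EFin_mean; last exact: L2_mul.
  by apply: eq_integral => x _; rewrite /= powR_mulrn// real_normK ?num_real.
by rewrite poweR12_sqrt// lee_fin inner_ge0.
Qed.

Lemma Lnorm2_sqr h : mu.-L2 h ->
  ('N[mu]_2%:E[EFin \o h] ^+ 2 = (inner mu h h)%:E)%E.
Proof.
by move=> h2; rewrite Lnorm2_inner// -EFin_expe sqr_sqrtr// inner_ge0.
Qed.

Lemma Lnorm1_mean h : mu.-L1 h ->
  ('N[mu]_1[EFin \o h] = (mean mu (fun x => `|h x|))%:E)%E.
Proof. by move=> h1; rewrite Lnorm1 EFin_mean//; exact: L1_norm. Qed.

End square_integrable.

(** * Averages over Markov kernels dominated by pi *)

Section dominated_kernel.
Context (R : realType) d (D : measurableType d) (pi : probability D R).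

(* Both [K] under pi and the point mass at [X n] under the law of the chain are
   of this form; averaging over the former is the transition operator, over the
   latter composition with [X n]. *)
Definition dominated_kernel d1 (T : measurableType d1) (m : probability T R)
    (C : R) (k : T -> {measure set D -> \bar R}) : Prop :=
  [/\ forall U, measurable U -> measurable_fun setT (k ^~ U),
      forall x, k x setT = 1%E
    & forall U, measurable U -> (\int[m]_x k x U <= C%:E * pi U)%E].

Definition average d1 (T : measurableType d1)
    (k : T -> {measure set D -> \bar R}) (h : D -> R) : T -> R :=
  fun x => \int[k x]_y h y.

Section one_kernel.
Context d1 (T : measurableType d1) (m : probability T R) (C : R)
  (k : T -> {measure set D -> \bar R}).
Hypothesis hk : dominated_kernel m C k.
Implicit Types f g h : D -> R.

Let mk U : measurable U -> measurable_fun setT (k ^~ U).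
Proof. by case: hk => + _ _; apply. Qed.

Let kT x : k x setT = 1%E.
Proof. by case: hk. Qed.

Let C0 : 0 <= C.
Proof.
have [_ _ /(_ _ measurableT)] := hk.
rewrite [X in (_ <= _ * X)%E]probability_setT mule1 -lee_fin; apply: le_trans.
exact: integral_ge0.
Qed.

Lemma le_integral_dominated_kernel (f : D -> \bar R) :
  measurable_fun setT f -> (forall x, 0 <= f x)%E ->
  (\int[m]_x \int[k x]_y f y <= C%:E * \int[pi]_y f y)%E.
Proof.
have mI (g : D -> \bar R) : measurable_fun setT g -> (forall x, 0 <= g x)%E ->
    measurable_fun setT (fun x => \int[k x]_y g y)%E.
  by move=> mg g0; exact: measurable_fun_integral_kernel.
move: f; apply: ge0_measurable_fun_ind.
- move=> A mA; under eq_integral do rewrite integral_indic// setIT.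
  by rewrite integral_indic// setIT; case: hk => _ _; apply.
- move=> r f r0 mf f0 IH.
  under eq_integral do rewrite ge0_integralZl_EFin//.
  rewrite !ge0_integralZl_EFin//; last 2 first.
    by move=> x _; exact: integral_ge0.
    exact: mI.
  by rewrite muleCA lee_wpmul2l.
- move=> f g mf f0 mg g0 IHf IHg.
  under eq_integral do rewrite ge0_integralD//.
  rewrite [leLHS]ge0_integralD//; try exact: mI; try by move=> x _; exact: integral_ge0.
  by rewrite [in leRHS]ge0_integralD// ge0_muleDr ?integral_ge0//; exact: leeD.
- move=> F mF F0 ndF IH.
  have ndI dT (S : measurableType dT) (l : {measure set S -> \bar R}) G :
      (forall n, measurable_fun setT (G n)) -> (forall n x, 0 <= G n x)%E ->
      (forall x, nondecreasing_seq (G ^~ x)) ->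
      nondecreasing_seq (fun n => \int[l]_y G n y)%E.
    by move=> mG G0 ndG a b ab; apply: ge0_le_integral => // y _; exact: ndG.
  under eq_integral do rewrite monotone_convergence//.
  rewrite !monotone_convergence//; last 3 first.
    by move=> n; exact: mI.
    by move=> n x _; exact: integral_ge0.
    by move=> x _; exact: ndI.
  have cF : cvgn (fun n => \int[pi]_y F n y)%E.
    by apply: ereal_nondecreasing_is_cvgn; exact: ndI.
  rewrite -limeMl//.
  apply: lee_lim; last by apply: nearW => n; exact: IH.
  + apply: ereal_nondecreasing_is_cvgn.
    apply: (ndI _ _ m (fun n x => \int[k x]_y F n y)%E).
    * by move=> n; exact: mI.
    * by move=> n x; exact: integral_ge0.
    * by move=> x; exact: ndI.
  + exact: is_cvgeMl.
Qed.

(** By domination the iterated integral of |h| is finite, hence the inner one is finite almost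
    everywhere. Linearity, Jensen and the triangle inequality for [average] hold on this set. *)
Lemma L1_ae_kernel h : pi.-L1 h -> \forall x \ae m, (k x).-L1 h.
Proof.
move=> h1; have mh := L1_measurable h1.
have mnh : measurable_fun setT (fun y => `|h y|%:E).
  by apply/measurable_EFinP; exact: measurableT_comp.
have : m.-integrable setT (fun x => \int[k x]_y `|h y|%:E)%E.
  apply/integrableP; split; first exact: measurable_fun_integral_kernel.
  under eq_integral do rewrite gee0_abs ?integral_ge0//.
  apply: le_lt_trans; first exact: le_integral_dominated_kernel.
  by apply: lte_mul_pinfty => //; have /integrableP[] := h1.
move=> /(integrable_ae measurableT); apply: filterS => x /= /(_ I).
rewrite ge0_fin_numE ?integral_ge0// => hx.
by apply/integrableP; split => //; exact/measurable_EFinP.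
Qed.

Lemma measurable_average h : measurable_fun setT h ->
  measurable_fun setT (average k h).
Proof.
move=> mh; apply: (@measurableT_comp _ _ _ _ _ _ fine) => //.
under eq_fun do rewrite integralE.
have mhE : measurable_fun setT (EFin \o h) by exact/measurable_EFinP.
apply: emeasurable_funB; apply: measurable_fun_integral_kernel => //.
  exact: measurable_funepos.
exact: measurable_funeneg.
Qed.

Lemma EFin_average x h : (k x).-L1 h ->
  (average k h x)%:E = (\int[k x]_y (h y)%:E)%E.
Proof. by move=> h1; rewrite fineK//; exact: integrable_fin_num. Qed.

Lemma average_L1 h : pi.-L1 h -> m.-L1 (average k h).
Proof.
move=> h1; have mh := L1_measurable h1.
have mnh : measurable_fun setT (fun y => `|h y|%:E).
  by apply/measurable_EFinP; exact: measurableT_comp.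
apply/integrableP; split; first exact/measurable_EFinP/measurable_average.
apply: (@le_lt_trans _ _ (\int[m]_x \int[k x]_y `|h y|%:E)%E); last first.
  apply: le_lt_trans; first exact: le_integral_dominated_kernel.
  by apply: lte_mul_pinfty => //; have /integrableP[] := h1.
apply: ae_ge0_le_integral => //.
- by apply: measurableT_comp => //; exact/measurable_EFinP/measurable_average.
- by move=> x _; exact: integral_ge0.
- exact: measurable_fun_integral_kernel.
apply: filterS (L1_ae_kernel h1) => x hx _ /=.
rewrite -abse_EFin EFin_average//; apply: le_abse_integral => //.
exact: measurable_int hx.
Qed.

Lemma average_lin a f g : pi.-L1 f -> pi.-L1 g ->
  average k (fun x => a * f x + g x) =
  (fun x => a * average k f x + average k g x) %[ae m].
Proof.
move=> f1 g1; apply: filterS2 (L1_ae_kernel f1) (L1_ae_kernel g1) => x fx gx _.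
rewrite /average RintegralD//; first by rewrite RintegralZl.
by have := integrableZl measurableT a fx; apply: eq_integrable => // y _ /=; rewrite EFinM.
Qed.

Lemma le_normr_average h : pi.-L1 h ->
  \forall x \ae m, `|average k h x| <= average k (fun y => `|h y|) x.
Proof.
by move=> h1; apply: filterS (L1_ae_kernel h1) => x hx; exact: le_normr_Rintegral.
Qed.

(** Jensen's inequality for the square: the variance of h under the probability [k x] is
    nonnegative. *)
Lemma sqr_average_le h : pi.-L2 h ->
  \forall x \ae m, average k h x ^+ 2 <= average k (fun y => h y ^+ 2) x.
Proof.
move=> h2; have [_ hh] := (L2P pi h).1 h2.
apply: filterS2 (L1_ae_kernel (L2_L1 h2)) (L1_ae_kernel hh) => x hx hhx.
set c := average k h x.
have kc r : (k x).-L1 (cst r).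
  apply/integrableP; split; first exact/measurable_EFinP.
  by rewrite (eq_integral (cst `|r|%:E))// integral_cst// kT mule1 ltry.
have : 0 <= \int[k x]_y (h y - c) ^+ 2.
  by apply: Rintegral_ge0 => y _; exact: sqr_ge0.
have -> : (\int[k x]_y (h y - c) ^+ 2) =
    \int[k x]_y ((- (c *+ 2) * h y + h y ^+ 2) + c ^+ 2).
  by apply: eq_Rintegral => y _; ring.
have Zh : (k x).-L1 (fun y => - (c *+ 2) * h y).
  have := integrableZl measurableT (- (c *+ 2)) hx.
  by apply: eq_integrable => // y _ /=; rewrite EFinM.
have Dh : (k x).-L1 (fun y => - (c *+ 2) * h y + h y ^+ 2).
  by have := integrableD measurableT Zh hhx; apply: eq_integrable => // y _ /=; rewrite EFinD.
rewrite RintegralD//; last exact: kc.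
rewrite RintegralD// RintegralZl// Rintegral_cst// kT mulr1.
rewrite -/(average k h x) -/c -/(average k (fun y => h y ^+ 2) x); lra.
Qed.

Lemma average_L2 h : pi.-L2 h -> m.-L2 (average k h).
Proof.
move=> h2; have [mh hh] := (L2P pi h).1 h2.
apply/L2P; split; first exact: measurable_average.
have /integrableP[ma ha] := average_L1 hh; apply/integrableP; split.
  by apply/measurable_EFinP/measurable_funX; exact: measurable_average.
apply: le_lt_trans ha; apply: ae_ge0_le_integral => //.
- apply: measurableT_comp => //; apply/measurable_EFinP/measurable_funX.
  exact: measurable_average.
- exact: measurableT_comp.
apply: filterS (sqr_average_le h2) => x hx _ /=.
by rewrite lee_fin ger0_norm ?sqr_ge0// (le_trans hx)// ler_norm.
Qed.

Lemma EFin_average_ae h : pi.-L1 h ->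
  \forall x \ae m, (average k h x)%:E = (\int[k x]_y (h y)%:E)%E.
Proof. by move=> h1; apply: filterS (L1_ae_kernel h1) => x; exact: EFin_average. Qed.

End one_kernel.
End dominated_kernel.

(** * Equality of averages: from sets to functions *)

Section equal_averages.
Context (R : realType) d (D : measurableType d) (pi : probability D R).
Implicit Types f g h : D -> R.

(** The shape a f + g is the one to which the [_lin] lemmas apply. *)
Lemma funrposnegE h : h = (fun x => -1 * h^\- x + h^\+ x).
Proof. by apply/funext => x; rewrite mulN1r addrC -{1}(funrposBneg h). Qed.

Lemma le_funrpos_norm h x : `|h^\+ x| <= `|h x|.
Proof.
have -> : `|h x| = h^\+ x + h^\- x by have /(congr1 (@^~ x)) := funrposDneg h.
by rewrite ger0_norm// lerDl.
Qed.

Lemma le_funrneg_norm h x : `|h^\- x| <= `|h x|.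
Proof.
have -> : `|h x| = h^\+ x + h^\- x by have /(congr1 (@^~ x)) := funrposDneg h.
by rewrite ger0_norm// lerDr.
Qed.

Lemma L1_posneg h : pi.-L1 h -> pi.-L1 h^\+ /\ pi.-L1 h^\-.
Proof.
move=> h1; have mh := L1_measurable h1; split; apply: le_L1 (L1_norm h1).
- exact: measurable_funrpos.
- exact: le_funrpos_norm.
- exact: measurable_funrneg.
- exact: le_funrneg_norm.
Qed.

Lemma L2_posneg h : pi.-L2 h -> pi.-L2 h^\+ /\ pi.-L2 h^\-.
Proof.
move=> h1; have mh := L2_measurable h1; split; apply: le_L2 h1.
- exact: measurable_funrpos.
- exact: le_funrpos_norm.
- exact: measurable_funrneg.
- exact: le_funrneg_norm.
Qed.

Section mean_of_average.
Context d1 (T : measurableType d1) (m : probability T R) (C : R)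
  (k : T -> {measure set D -> \bar R}) (hk : dominated_kernel pi m C k).

Lemma mean_average_lin a f g : pi.-L1 f -> pi.-L1 g ->
  mean m (average k (fun x => a * f x + g x)) =
  a * mean m (average k f) + mean m (average k g).
Proof.
move=> f1 g1; rewrite -mean_lin; try exact: (average_L1 hk).
apply: ae_eq_mean (average_lin hk a f1 g1).
- by apply: (average_L1 hk); exact: L1_lin.
- by apply: L1_lin; exact: (average_L1 hk).
Qed.

Lemma inner_average_lin a f g (h : T -> R) : pi.-L2 f -> pi.-L2 g -> m.-L2 h ->
  inner m (average k (fun x => a * f x + g x)) h =
  a * inner m (average k f) h + inner m (average k g) h.
Proof.
move=> f2 g2 h2; rewrite -inner_lin//; try exact: (average_L2 hk).
apply: ae_eq_inner => //; last exact: (average_lin hk a (L2_L1 f2) (L2_L1 g2)).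
- by apply: (average_L2 hk); exact: L2_lin.
- by apply: L2_lin; exact: (average_L2 hk).
Qed.

Lemma inner_average_linr a f g (h : T -> R) :
  pi.-L2 f -> pi.-L2 g -> m.-L2 h ->
  inner m h (average k (fun x => a * f x + g x)) =
  a * inner m h (average k f) + inner m h (average k g).
Proof. by move=> *; rewrite !(innerC m h) inner_average_lin. Qed.

Lemma EFin_mean_average h : pi.-L1 h ->
  ((mean m (average k h))%:E = \int[m]_x \int[k x]_y (h^\+ y)%:E
                             - \int[m]_x \int[k x]_y (h^\- y)%:E)%E.
Proof.
move=> h1; have [hp1 hn1] := L1_posneg h1.
have mk := let: And3 mk _ _ := hk in mk.
have E f : pi.-L1 f -> (forall y, 0 <= f y) ->
    (\int[m]_x \int[k x]_y (f y)%:E = (mean m (average k f))%:E)%E.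
  move=> f1 f0; rewrite EFin_mean; last exact: (average_L1 hk).
  have mf := L1_measurable f1.
  apply: ae_eq_integral => //.
  - apply: measurable_fun_integral_kernel => //; exact/measurable_EFinP.
  - by apply/measurable_EFinP; apply: (measurable_average hk).
  - by apply: filterS (EFin_average_ae hk f1) => x ->.
rewrite !E// {1}(funrposnegE h) mean_average_lin// EFinD mulN1r EFinN addeC//.
Qed.

End mean_of_average.

Lemma eq_mean_average d1 d2 (T : measurableType d1) (T' : measurableType d2)
    (m : probability T R) (m' : probability T' R) (C C' : R)
    (k : T -> {measure set D -> \bar R}) (k' : T' -> {measure set D -> \bar R}) :
  dominated_kernel pi m C k -> dominated_kernel pi m' C' k' ->
  (forall U, measurable U -> \int[m]_x k x U = \int[m']_x k' x U)%E ->
  forall h, pi.-L1 h -> mean m (average k h) = mean m' (average k' h).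
Proof.
move=> hk hk' kk' h h1; have [mk _ _] := hk; have [mk' _ _] := hk'.
have E (f : D -> R) : measurable_fun setT f -> (forall y, 0 <= f y) ->
    (\int[m]_x \int[k x]_y (f y)%:E = \int[m']_x \int[k' x]_y (f y)%:E)%E.
  move=> mf f0; have mfE : measurable_fun setT (EFin \o f) by exact/measurable_EFinP.
  have := weighted_integral_kernel_eq mk mk' (@measurable_cst _ _ _ _ setT 1%E)
    (@measurable_cst _ _ _ _ setT 1%E) (fun=> lee01) (fun=> lee01).
  move=> /(_ m m' _ (EFin \o f) mfE f0).
  under eq_integral do rewrite mul1e.
  under [RHS]eq_integral do rewrite mul1e.
  apply=> U mU.
  under eq_integral do rewrite mul1e.
  under [RHS]eq_integral do rewrite mul1e.
  exact: kk'.
have mh := L1_measurable h1.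
apply: EFin_inj; rewrite (EFin_mean_average hk)// (EFin_mean_average hk')//.
by rewrite !E//; [exact: measurable_funrneg|exact: measurable_funrpos].
Qed.

(** Two uses of [weighted_integral_kernel_eq] for nonnegative functions, first in [k2] with weight
    [k1 x A], then in [k1] with the integral of h as weight; bilinearity and the splitting into
    positive and negative parts give the rest. *)
Lemma eq_inner_average d1 d2 (T : measurableType d1) (T' : measurableType d2)
    (m : probability T R) (m' : probability T' R) (C1 C2 C1' C2' : R)
    (k1 k2 : T -> {measure set D -> \bar R})
    (k1' k2' : T' -> {measure set D -> \bar R}) :
  dominated_kernel pi m C1 k1 -> dominated_kernel pi m C2 k2 ->
  dominated_kernel pi m' C1' k1' -> dominated_kernel pi m' C2' k2' ->
  (forall A B, measurable A -> measurable B ->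
    \int[m]_x (k1 x A * k2 x B) = \int[m']_x (k1' x A * k2' x B))%E ->
  forall f h, pi.-L2 f -> pi.-L2 h ->
  inner m (average k1 f) (average k2 h) =
  inner m' (average k1' f) (average k2' h).
Proof.
move=> hk1 hk2 hk1' hk2' kk'.
have [mk1 _ _] := hk1; have [mk2 _ _] := hk2.
have [mk1' _ _] := hk1'; have [mk2' _ _] := hk2'.
have EI f h : pi.-L2 f -> pi.-L2 h ->
    (forall y, 0 <= f y) -> (forall y, 0 <= h y) ->
    inner m (average k1 f) (average k2 h) =
    inner m' (average k1' f) (average k2' h).
  move=> f2 h2 f0 h0.
  have mf : measurable_fun setT (EFin \o f).
    by apply/measurable_EFinP; exact: L2_measurable f2.
  have mh : measurable_fun setT (EFin \o h).
    by apply/measurable_EFinP; exact: L2_measurable h2.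
  have I dS (S : measurableType dS) (l : probability S R) c1 c2 l1 l2 :
      dominated_kernel pi l c1 l1 -> dominated_kernel pi l c2 l2 ->
      ((inner l (average l1 f) (average l2 h))%:E =
        \int[l]_x (\int[l1 x]_y (f y)%:E * \int[l2 x]_y (h y)%:E))%E.
    move=> hl1 hl2.
    rewrite (EFin_mean (L2_mul (average_L2 hl1 f2) (average_L2 hl2 h2))).
    have [ml1 _ _] := hl1; have [ml2 _ _] := hl2.
    apply: ae_eq_integral => //.
    - apply/measurable_EFinP; apply: measurable_funM.
        by apply: (measurable_average hl1); exact: L2_measurable f2.
      by apply: (measurable_average hl2); exact: L2_measurable h2.
    - by apply: emeasurable_funM; apply: measurable_fun_integral_kernel.
    - apply: filterS2 (EFin_average_ae hl1 (L2_L1 f2))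
        (EFin_average_ae hl2 (L2_L1 h2)) => x fx hx _.
      by rewrite EFinM fx hx.
  apply: EFin_inj; rewrite (I _ _ _ _ _ _ _ hk1 hk2) (I _ _ _ _ _ _ _ hk1' hk2').
  have step1 A : measurable A ->
      (\int[m]_x (k1 x A * \int[k2 x]_y (h y)%:E) =
       \int[m']_x (k1' x A * \int[k2' x]_y (h y)%:E))%E.
    move=> mA; apply: (weighted_integral_kernel_eq mk2 mk2') => //.
    + exact: mk1.
    + exact: mk1'.
    + by move=> U mU; exact: kk'.
  under eq_integral do rewrite muleC.
  under [RHS]eq_integral do rewrite muleC.
  apply: (weighted_integral_kernel_eq mk1 mk1') => //.
  - exact: measurable_fun_integral_kernel.
  - exact: measurable_fun_integral_kernel.
  - by move=> x; apply: integral_ge0 => y _; rewrite lee_fin.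
  - by move=> x; apply: integral_ge0 => y _; rewrite lee_fin.
  - move=> U mU.
    under eq_integral do rewrite muleC.
    under [RHS]eq_integral do rewrite muleC.
    exact: step1.
move=> f h f2 h2.
have [fp2 fn2] := L2_posneg f2; have [hp2 hn2] := L2_posneg h2.
rewrite (funrposnegE f) (funrposnegE h).
rewrite (inner_average_lin hk1)//; last by apply: (average_L2 hk2); exact: L2_lin.
rewrite (inner_average_lin hk1')//; last by apply: (average_L2 hk2'); exact: L2_lin.
rewrite !(inner_average_linr hk2)//; try exact: (average_L2 hk1).
rewrite !(inner_average_linr hk2')//; try exact: (average_L2 hk1').
by rewrite !EI//; try (exact: funrpos_ge0 || exact: funrneg_ge0).
Qed.

End equal_averages.

(** * Symmetric contractions on semi-inner product spaces *)

(* The elements of L_2 are functions, so that [b] is only semi-definite and the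
   operator [T] below is linear up to null functions only; all identities are
   therefore tested against [b]. [lin a x y] stands for a x + y. *)
Definition semi_inner (R : realType) (V : Type) (W : V -> Prop)
    (lin : R -> V -> V -> V) (b : V -> V -> R) : Prop :=
  [/\ forall a x y, W x -> W y -> W (lin a x y),
      forall a x y z, W x -> W y -> W z -> b (lin a x y) z = a * b x z + b y z,
      forall x y, W x -> W y -> b x y = b y x
    & forall x, W x -> 0 <= b x x].

Definition bnorm (R : realType) (V : Type) (b : V -> V -> R) (x : V) : R :=
  Num.sqrt (b x x).

(** [V] has no zero vector of its own; the base case [lin (-1) (v 0%N) (v 0%N)] is a null vector for
    every semi-inner product. *)
Fixpoint psum (R : realType) (V : Type) (lin : R -> V -> V -> V) (v : nat -> V)
    (n : nat) : V :=
  if n is n'.+1 then lin 1 (v n') (psum lin v n') else lin (-1) (v 0%N) (v 0%N).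

Section semi_inner.
Context (R : realType) (V : Type) (W : V -> Prop) (lin : R -> V -> V -> V).
Implicit Types (b : V -> V -> R) (x y z : V).

Lemma semi_inner_linr b : semi_inner W lin b -> forall a x y z,
  W x -> W y -> W z -> b z (lin a x y) = a * b z x + b z y.
Proof. by move=> [Wl bl bC _] a x y z Wx Wy Wz; rewrite bC ?bl// ?(bC z)//; exact: Wl. Qed.

Lemma cauchy_schwarz b : semi_inner W lin b -> forall x y, W x -> W y ->
  b x y ^+ 2 <= b x x * b y y.
Proof.
move=> hb x y Wx Wy; have [Wl bl bC b0] := hb.
have q t : 0 <= t ^+ 2 * b x x + t *+ 2 * b x y + b y y.
  have := b0 _ (Wl t x y Wx Wy).
  rewrite bl//; last exact: Wl.
  rewrite !(semi_inner_linr hb)// (bC y x)//.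
  by congr (_ <= _); ring.
have [xx0|xx0] := eqVneq (b x x) 0.
  have [->|xy0] := eqVneq (b x y) 0; first by rewrite expr0n xx0 mul0r.
  (* The quadratic in t is affine here; this t makes its value -1. *)
  have := q (- (b y y + 1) / (b x y *+ 2)).
  have -> : (- (b y y + 1) / (b x y *+ 2)) ^+ 2 * b x x +
      (- (b y y + 1) / (b x y *+ 2)) *+ 2 * b x y + b y y = -1.
    by rewrite xx0; field; rewrite xy0.
  by rewrite oppr_ge0 ler10.
have xxp : 0 < b x x by rewrite lt_neqAle eq_sym xx0 b0.
(* The minimiser of the quadratic. *)
have := q (- b x y / b x x).
have -> : (- b x y / b x x) ^+ 2 * b x x + (- b x y / b x x) *+ 2 * b x y +
    b y y = b y y - b x y ^+ 2 / b x x.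
  by field; rewrite gt_eqF.
by rewrite subr_ge0 ler_pdivrMr// mulrC.
Qed.

Context b (hb : semi_inner W lin b).
Local Notation nrm := (bnorm b).

Let Wl a x y : W x -> W y -> W (lin a x y). Proof. by case: hb => + _ _ _; apply. Qed.
Let bl a x y z : W x -> W y -> W z -> b (lin a x y) z = a * b x z + b y z.
Proof. by case: hb => _ + _ _; apply. Qed.
Let bC x y : W x -> W y -> b x y = b y x.
Proof. by case: hb => _ _ + _; apply. Qed.
Let b0 x : W x -> 0 <= b x x. Proof. by case: hb => _ _ _; apply. Qed.
Let blr := semi_inner_linr hb.

Lemma bnorm_ge0 x : 0 <= nrm x. Proof. exact: sqrtr_ge0. Qed.

Lemma sqr_bnorm x : W x -> nrm x ^+ 2 = b x x.
Proof. by move=> Wx; rewrite sqr_sqrtr// b0. Qed.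

Lemma normr_b_le x y : W x -> W y -> `|b x y| <= nrm x * nrm y.
Proof.
move=> Wx Wy; rewrite -sqrtrM ?b0// -sqrtr_sqr ler_wsqrtr//.
exact: cauchy_schwarz.
Qed.

Lemma bnorm_le x c : W x -> 0 <= c -> (nrm x <= c) = (b x x <= c ^+ 2).
Proof.
by move=> Wx c0; rewrite -sqr_bnorm// ler_pXn2r// nnegrE bnorm_ge0.
Qed.

Lemma bnorm_lin_le a x y : W x -> W y -> nrm (lin a x y) <= `|a| * nrm x + nrm y.
Proof.
move=> Wx Wy; rewrite bnorm_le; last 2 first.
- exact: Wl.
- by rewrite addr_ge0 ?mulr_ge0 ?bnorm_ge0.
rewrite bl//; last exact: Wl.
rewrite !blr// (bC Wy Wx) sqrrD -!sqr_bnorm// exprMn real_normK ?num_real//.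
have : a * b x y <= `|a| * (nrm x * nrm y).
  by apply: le_trans (ler_norm _) _; rewrite normrM ler_wpM2l// normr_b_le.
lra.
Qed.

Section symmetric_operator.
Context (T : V -> V) (alpha : R).
Hypotheses (WT : forall x, W x -> W (T x))
  (Tsym : forall x y, W x -> W y -> b (T x) y = b x (T y)).

Lemma W_iter n x : W x -> W (iter n T x).
Proof. by move=> Wx; elim: n => //= n; exact: WT. Qed.

Lemma iter_sym n x y : W x -> W y -> b (iter n T x) y = b x (iter n T y).
Proof.
elim: n y => // n IH y Wx Wy; rewrite iterS Tsym//; last exact: W_iter.
by rewrite IH//; [rewrite iterSr|exact: WT].
Qed.

Lemma b_iter n k x y : W x -> W y ->
  b (iter n T x) (iter k T y) = b x (iter (n + k) T y).
Proof. by move=> Wx Wy; rewrite iter_sym//; [rewrite -iterD|exact: W_iter]. Qed.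

(* The sequence b(T^n x, T^n x) is log-convex, hence its first ratio is at most
   its asymptotic growth rate. *)
Lemma contraction_of_decay x c : W x -> 0 <= alpha ->
  (forall n, (0 < n)%N -> b (iter n T x) (iter n T x) <= c * (alpha ^+ 2) ^+ n) ->
  b (T x) (T x) <= alpha ^+ 2 * b x x.
Proof.
move=> Wx alpha0 decay; pose a n := b (iter n T x) (iter n T x).
rewrite -[b (T x) (T x)]/(a 1%N) -[b x x]/(a 0%N).
have a0 n : 0 <= a n by apply: b0; exact: W_iter.
have lc n : a n.+1 ^+ 2 <= a n * a n.+2.
  have := cauchy_schwarz hb (W_iter n Wx) (W_iter n.+2 Wx).
  by rewrite /a !b_iter// addSnnS addnS.
rewrite leNgt; apply/negP => a1.
have a1p : 0 < a 1%N by apply: le_lt_trans a1; rewrite mulr_ge0 ?sqr_ge0.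
have a0p : 0 < a 0%N.
  rewrite lt_neqAle a0 andbT eq_sym; apply/eqP => a00.
  by have := lc 0%N; rewrite a00 mul0r leNgt exprn_gt0.
pose r := a 1%N / a 0%N.
have ra : alpha ^+ 2 < r by rewrite /r ltr_pdivlMr.
have r0 : 0 < r by rewrite divr_gt0.
have grow n : 0 < a n /\ r * a n <= a n.+1.
  elim: n => [|n [an IH]]; first by rewrite /r mulfVK ?gt_eqF.
  have an1 : 0 < a n.+1 by apply: lt_le_trans IH; rewrite mulr_gt0.
  split=> //; rewrite -(ler_pM2l an); apply: le_trans (lc n).
  by rewrite expr2 mulrCA mulrA ler_pM2r.
have geo n : r ^+ n * a 0%N <= a n.
  elim: n => [|n IH]; first by rewrite expr0 mul1r.
  apply: le_trans (grow n).2; rewrite exprS -mulrA ler_pM2l//.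
have c0 : 0 < c.
  rewrite ltNge; apply/negP => c0; have := decay 1%N isT.
  rewrite leNgt => /negP; apply; apply: le_lt_trans a1p.
  by rewrite expr1 mulr_le0_ge0 ?sqr_ge0.
(* Growth contradicts decay: (alpha^2 / r)^n tends to 0, while r^n a_0 <= a_n <= c alpha^(2n) keeps
   it above a_0 / c for n >= 1. *)
have : (fun n => (alpha ^+ 2 / r) ^+ n) @ \oo --> 0.
  apply: cvg_expr; rewrite ger0_norm ?divr_ge0 ?sqr_ge0 ?(ltW r0)//.
  by rewrite ltr_pdivrMr// mul1r.
move=> /cvgrPdist_lt /(_ (a 0%N / c)); rewrite divr_gt0// => /(_ isT)[N _ HN].
have := HN N.+1 (leqnSn N); rewrite /= sub0r normrN.
apply/negP; rewrite -leNgt.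
rewrite ger0_norm ?exprn_ge0 ?divr_ge0 ?sqr_ge0 ?(ltW r0)//.
rewrite expr_div_n ler_pdivlMr ?exprn_gt0// mulrAC ler_pdivrMr//.
rewrite mulrC [leRHS]mulrC; exact: le_trans (geo N.+1) (decay N.+1 isT).
Qed.

(** With g = u - T u and A = b(u, g): Cauchy-Schwarz gives A^2 <= |g|^2 |u|^2, the numerical range
    bound gives (1 - lambda) |u|^2 <= A, and a positive A cancels. This is the source of the factor
    1 / (1 - Lambda). *)
Lemma gap_inequality lambda u : W u -> lambda < 1 ->
  (forall x, W x -> b (T x) x <= lambda * b x x) ->
  (1 - lambda) * (b u u - b (T u) u) <= b (lin (-1) (T u) u) (lin (-1) (T u) u).
Proof.
move=> Wu lambda1 hlambda; set g := lin _ _ _.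
have Wg : W g by apply: Wl => //; exact: WT.
set A := b u u - b (T u) u.
have gu : b g u = A by rewrite bl//; [rewrite mulN1r addrC|exact: WT].
have [A0|A0] := leP A 0.
  apply: le_trans (b0 Wg); rewrite mulr_ge0_le0// subr_ge0; exact: ltW.
have cs : A ^+ 2 <= b g g * b u u by rewrite -gu; exact: cauchy_schwarz.
have lA : (1 - lambda) * b u u <= A.
  by rewrite /A mulrBl mul1r lerD2l lerN2; exact: hlambda.
rewrite -(ler_pM2r A0) -mulrA -expr2.
have l0 : 0 <= 1 - lambda by rewrite subr_ge0 ltW.
apply: le_trans (ler_wpM2l l0 cs) _.
by rewrite mulrCA ler_wpM2l// b0.
Qed.

Section contraction.
Hypotheses (alpha0 : 0 <= alpha) (alpha1 : alpha < 1).
Hypothesis Tcontr : forall x, W x -> b (T x) (T x) <= alpha ^+ 2 * b x x.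

Lemma bnorm_T_le x : W x -> nrm (T x) <= alpha * nrm x.
Proof.
move=> Wx; rewrite bnorm_le ?mulr_ge0 ?bnorm_ge0//; last exact: WT.
by rewrite exprMn sqr_bnorm//; exact: Tcontr.
Qed.

Lemma bnorm_iter_le n x : W x -> nrm (iter n T x) <= alpha ^+ n * nrm x.
Proof.
move=> Wx; elim: n => [|n IH]; first by rewrite mul1r.
apply: le_trans (bnorm_T_le (W_iter n Wx)) _.
by rewrite exprS -mulrA ler_wpM2l.
Qed.

Lemma normr_b_T_le x : W x -> `|b (T x) x| <= alpha * b x x.
Proof.
move=> Wx; apply: le_trans (normr_b_le (WT Wx) Wx) _.
by rewrite -(sqr_bnorm Wx) expr2 mulrA ler_wpM2r ?bnorm_ge0// bnorm_T_le.
Qed.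

(* With A = lambda - T >= 0, the Cauchy-Schwarz inequality for b(A x, y) gives
   |A x|^2 <= 2 b(A x, x), so that A is not bounded below when the numerical
   range of T approaches lambda. *)
Lemma numerical_range_gap lambda c : lambda <= 1 ->
  (forall x, W x -> b (T x) x <= lambda * b x x) ->
  (forall x, W x ->
    b x x <= c * b (lin lambda x (lin (-1) (T x) (lin (-1) x x)))
                   (lin lambda x (lin (-1) (T x) (lin (-1) x x)))) ->
  exists2 e, 0 < e & forall x, W x -> b (T x) x <= (lambda - e) * b x x.
Proof.
move=> lambda1 hlambda hc.
(* [lin (-1) x x] stands for 0, so that [A x] is lambda x - T x. *)
pose A x := lin lambda x (lin (-1) (T x) (lin (-1) x x)).
have WA x : W x -> W (A x) by move=> Wx; do ![apply: Wl => //]; exact: WT.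
have bA x y : W x -> W y -> b (A x) y = lambda * b x y - b (T x) y.
  move=> Wx Wy; have WTx := WT Wx; rewrite bl//; last by apply: Wl => //; exact: Wl.
  by rewrite bl//; [rewrite bl//; ring|exact: Wl].
have hA : semi_inner W lin (fun x y => b (A x) y).
  split=> //.
  - move=> a x y z Wx Wy Wz; rewrite !bA//; last exact: Wl.
    rewrite bl// Tsym//; last exact: Wl.
    rewrite bl//; last exact: WT.
    by rewrite !Tsym//; ring.
  - by move=> x y Wx Wy; rewrite !bA// Tsym// (bC Wx Wy) (bC Wx (WT Wy)).
  - by move=> x Wx; rewrite bA// subr_ge0 hlambda.
have A2 x : W x -> b (A x) (A x) <= 2 * (lambda * b x x - b (T x) x).
  move=> Wx; have WAx := WA _ Wx.
  have cs := cauchy_schwarz hA Wx WAx; rewrite /= (bA x x)// in cs.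
  (* lambda <= 1, and the numerical range of T is at least -alpha > -1, whence A <= 2 as a quadratic
     form. *)
  have AA : b (A (A x)) (A x) <= 2 * b (A x) (A x).
    rewrite bA//; have := normr_b_T_le WAx; rewrite ler_norml => /andP[Tl _].
    have := b0 WAx; move: (b (A x) (A x)) (b (T (A x)) (A x)) Tl => N t Tl N0.
    have : lambda * N <= N by rewrite ler_piMl.
    have : alpha * N <= N by rewrite ler_piMl// ltW.
    lra.
  have p0 : 0 <= lambda * b x x - b (T x) x by rewrite subr_ge0 hlambda.
  have [->|N0] := eqVneq (b (A x) (A x)) 0; first by rewrite mulr_ge0.
  have Np : 0 < b (A x) (A x) by rewrite lt_neqAle eq_sym N0 b0.
  rewrite -(ler_pM2r Np) -expr2; apply: le_trans cs _.
  by rewrite mulrC -mulrA [leRHS]mulrCA mulrC ler_wpM2l.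
(* The sign of c is not known; the maximum with 1 makes the gap 1 / (2 c') positive. *)
pose c' := Num.max c 1.
have c'0 : 0 < c' by rewrite lt_max ltr01 orbT.
exists (2 * c')^-1 => [|x Wx]; first by rewrite invr_gt0 mulr_gt0.
have : b x x <= c' * (2 * (lambda * b x x - b (T x) x)).
  apply: le_trans (hc _ Wx) _; apply: (@le_trans _ _ (c' * b (A x) (A x))).
    by rewrite ler_wpM2r ?b0 ?le_max ?lexx//; exact: WA.
  by rewrite ler_wpM2l ?A2// ltW.
rewrite mulrA (mulrC c') -ler_pdivrMl ?mulr_gt0//.
lra.
Qed.

Lemma numerical_range_approached : (exists2 x, W x & 0 < b x x) ->
  exists lambda, [/\ lambda <= alpha,
    forall x, W x -> b (T x) x <= lambda * b x x &
    forall e, 0 < e -> exists2 x, W x & (lambda - e) * b x x < b (T x) x].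
Proof.
move=> [x1 Wx1 x10].
pose E := [set r | exists x, [/\ W x, 0 < b x x & r = b (T x) x / b x x]].
have ubE : ubound E alpha.
  move=> _ [x [Wx x0 ->]]; rewrite ler_pdivrMr//.
  exact: le_trans (ler_norm _) (normr_b_T_le Wx).
have hE : has_sup E.
  split; last by exists alpha.
  by exists (b (T x1) x1 / b x1 x1), x1.
exists (sup E); split.
- by apply: ge_sup => //; case: hE.
- move=> x Wx; have [x0|x0] := eqVneq (b x x) 0.
    have := normr_b_T_le Wx; rewrite x0 mulr0 mulr0.
    exact: le_trans (ler_norm _).
  have x0' : 0 < b x x by rewrite lt_neqAle eq_sym x0 b0.
  by rewrite -ler_pdivrMr//; apply: sup_upper_bound => //; exists x.
- move=> e e0; have [_ [x [Wx x0 ->]] h] := sup_adherent e0 hE.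
  by exists x => //; rewrite -ltr_pdivlMr.
Qed.

(** A lower bound for lambda - T would give a gap below lambda, while lambda is the supremum of the
    Rayleigh quotients. Without a vector of positive norm there are no quotients. *)
Lemma numerical_range_not_bounded_below : (exists2 x, W x & 0 < b x x) ->
  exists lambda, [/\ lambda <= alpha,
    forall x, W x -> b (T x) x <= lambda * b x x &
    ~ exists c, forall x, W x ->
      b x x <= c * b (lin lambda x (lin (-1) (T x) (lin (-1) x x)))
                     (lin lambda x (lin (-1) (T x) (lin (-1) x x)))].
Proof.
move=> /numerical_range_approached[lambda [la lb lc]].
exists lambda; split => // -[c hc].
have l1 : lambda <= 1 by apply: le_trans la _; exact: ltW.
have [e e0 he] := numerical_range_gap l1 lb hc.
by have [x Wx] := lc _ e0; rewrite ltNge he.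
Qed.

Lemma eq0_of_geometric_bound (y k q : R) : 0 <= q -> q < 1 ->
  (forall n, `|y| <= k * q ^+ n) -> y = 0.
Proof.
move=> q0 q1 h.
have : (fun n => k * q ^+ n) @ \oo --> k * 0.
  by apply: cvgMr; apply: cvg_expr; rewrite ger0_norm.
rewrite mulr0 => /cvg_lim hk.
apply/eqP; rewrite -normr_eq0 eq_le normr_ge0 andbT -[leRHS]hk//.
apply: limr_ge; last by apply: nearW.
apply/cvg_ex; exists (k * 0).
by apply: cvgMr; apply: cvg_expr; rewrite ger0_norm.
Qed.

(** Completeness in the form that suits the Neumann series, with the geometric tail as explicit rate
    of convergence. *)
Definition geometrically_complete : Prop := forall (v : nat -> V) (c q : R),
  (forall k, W (v k)) -> 0 <= c -> 0 <= q -> q < 1 ->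
  (forall k, nrm (v k) <= c * q ^+ k) ->
  exists2 s, W s &
    forall n, nrm (lin (-1) (psum lin v n) s) <= c * q ^+ n / (1 - q).

Lemma W_psum v n : (forall k, W (v k)) -> W (psum lin v n).
Proof. by move=> Wv; elim: n => [|n IH]; apply: Wl. Qed.

(** Neumann series: s is the sum of a^-(k+1) T^k h, whose terms decay with ratio q = alpha / a; the
    resulting constant is 1 / (a - alpha). Symmetry moves T onto the test vector z and so replaces
    its linearity and continuity. *)
Lemma resolvent_exists a : geometrically_complete -> alpha < a ->
  exists2 c, 0 <= c & forall h, W h -> exists s, [/\ W s, nrm s <= c * nrm h &
    forall z, W z -> a * b s z - b (T s) z = b h z].
Proof.
move=> complete aa; have a0 : 0 < a by exact: le_lt_trans aa.
pose q := alpha / a.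
have q0 : 0 <= q by rewrite divr_ge0// ltW.
have q1 : q < 1 by rewrite ltr_pdivrMr// mul1r.
have q1' : 0 < 1 - q by rewrite subr_gt0.
exists (a^-1 / (1 - q)) => [|h Wh].
  by rewrite divr_ge0 ?invr_ge0// ltW.
(* [lin (t - 1) x x] encodes the multiple t x. *)
pose v k := lin (a ^- k.+1 - 1) (iter k T h) (iter k T h).
have Wi k : W (iter k T h) by exact: W_iter.
have Wv k : W (v k) by exact: Wl.
have bv k z : W z -> b (v k) z = a ^- k.+1 * b (iter k T h) z.
  by move=> Wz; rewrite bl//; ring.
have c0 : 0 <= a^-1 * nrm h by rewrite mulr_ge0 ?bnorm_ge0// invr_ge0 ltW.
have nv k : nrm (v k) <= a^-1 * nrm h * q ^+ k.
  have ak : 0 <= a ^- k.+1 by rewrite invr_ge0 exprn_ge0// ltW.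
  rewrite bnorm_le//; last by rewrite mulr_ge0// exprn_ge0.
  rewrite bv// bC// bv// mulrA -expr2 -sqr_bnorm// -exprMn.
  have key : a ^- k.+1 * nrm (iter k T h) <= a^-1 * nrm h * q ^+ k.
    apply: le_trans (ler_wpM2l ak (bnorm_iter_le k Wh)) _.
    by rewrite expr_div_n exprS invfM le_eqVlt; apply/orP; left; apply/eqP; ring.
  by rewrite lerXn2r// nnegrE; apply: mulr_ge0; rewrite ?bnorm_ge0 ?exprn_ge0.
have [s Ws hs] := complete v _ _ Wv c0 q0 q1 nv.
have WS n : W (psum lin v n) by exact: W_psum.
exists s; split => // [|z Wz].
  (* The case n = 0 of [hs]: the empty partial sum is null, so the tail bound is a bound for s
     itself. *)
  have W0 : W (psum lin v 0) by [].
  have z0 x : W x -> b (psum lin v 0) x = 0 by move=> Wx; rewrite bl//; ring.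
  rewrite mulrAC -[_ * nrm h]mulr1 -(expr0 q); apply: le_trans (hs 0%N).
  rewrite le_eqVlt; apply/orP; left; apply/eqP.
  rewrite /bnorm; congr Num.sqrt; rewrite bl//; last exact: Wl.
  rewrite z0 ?mulr0 ?add0r; last exact: Wl.
  by rewrite blr// (bC Ws W0) z0// mulr0 add0r.
have WTz := WT Wz.
have telescope n : a * b (psum lin v n) z - b (psum lin v n) (T z) =
    b h z - a ^- n * b (iter n T h) z.
  elim: n => [|n IH].
    by rewrite [iter 0 T h]/= !bl// expr0 invr1; ring.
  rewrite /= !bl// -(Tsym (Wi n) Wz) -[T (iter n T h)]/(iter n.+1 T h).
  have -> : b h z - a ^- n.+1 * b (iter n.+1 T h) z =
    (b h z - a ^- n * b (iter n T h) z) +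
    (a ^- n * b (iter n T h) z - a ^- n.+1 * b (iter n.+1 T h) z) by ring.
  by rewrite -IH exprS; field; rewrite ?expf_neq0 gt_eqF.
(* The difference of the two sides is a fixed number, bounded by a multiple of q^n for every n: two
   errors come from s minus its partial sum, one from the remainder of the telescoped sum. *)
apply/eqP; rewrite -subr_eq0; apply/eqP.
apply: (@eq0_of_geometric_bound _
  ((a * nrm z + nrm (T z)) * (a^-1 * nrm h / (1 - q)) + nrm h * nrm z) q) => // n.
set e := lin (-1) (psum lin v n) s.
have We : W e by exact: Wl.
have -> : a * b s z - b (T s) z - b h z =
    a * b e z - b e (T z) - a ^- n * b (iter n T h) z.
  have := telescope n; rewrite /e !bl// (Tsym Ws Wz); lra.
have he : nrm e <= a^-1 * nrm h * q ^+ n / (1 - q) := hs n.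
have h1 : `|a * b e z| <= a * nrm z * (a^-1 * nrm h * q ^+ n / (1 - q)).
  rewrite normrM (gtr0_norm a0) -mulrA ler_pM2l//.
  apply: le_trans (normr_b_le We Wz) _; rewrite mulrC.
  by rewrite ler_wpM2l// bnorm_ge0.
have h2 : `|b e (T z)| <= nrm (T z) * (a^-1 * nrm h * q ^+ n / (1 - q)).
  apply: le_trans (normr_b_le We WTz) _; rewrite mulrC.
  by rewrite ler_wpM2l// bnorm_ge0.
have h3 : `|a ^- n * b (iter n T h) z| <= nrm h * nrm z * q ^+ n.
  have an : 0 <= a ^- n by rewrite invr_ge0 exprn_ge0// ltW.
  rewrite normrM ger0_norm//.
  apply: le_trans (ler_wpM2l an (normr_b_le (Wi n) Wz)) _.
  rewrite expr_div_n mulrA [leRHS]mulrAC ler_wpM2r ?bnorm_ge0//.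
  apply: le_trans (ler_wpM2l an (bnorm_iter_le n Wh)) _.
  by rewrite le_eqVlt; apply/orP; left; apply/eqP; ring.
have := ler_normB (a * b e z - b e (T z)) (a ^- n * b (iter n T h) z).
have := ler_normB (a * b e z) (b e (T z)).
have -> : ((a * nrm z + nrm (T z)) * (a^-1 * nrm h / (1 - q)) + nrm h * nrm z) * q ^+ n =
  a * nrm z * (a^-1 * nrm h * q ^+ n / (1 - q)) +
  nrm (T z) * (a^-1 * nrm h * q ^+ n / (1 - q)) + nrm h * nrm z * q ^+ n by ring.
lra.
Qed.

End contraction.
End symmetric_operator.
End semi_inner.

(** * Variance of sums along the stationary chain *)

Section stationary_variance.
Context (R : realType) (V : Type) (W : V -> Prop) (lin : R -> V -> V -> V)
  (b : V -> V -> R) (hb : semi_inner W lin b) (T : V -> V) (alpha : R).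
Hypotheses (WT : forall x, W x -> W (T x))
  (Tsym : forall x y, W x -> W y -> b (T x) y = b x (T y))
  (alpha0 : 0 <= alpha) (alpha1 : alpha < 1)
  (Tcontr : forall x, W x -> b (T x) (T x) <= alpha ^+ 2 * b x x).

(* n^2 times the mean square error of the stationary chain *)
Definition stationary_sum_var (w : nat -> R) (n : nat) : R :=
  \sum_(0 <= j < n) (w 0%N + 2 * \sum_(0 <= k < j) w k.+1).

Context (u g : V) (Wu : W u) (Wg : W g).
Hypothesis gu : forall z, W z -> b g z = b u z - b (T u) z.

Let c k := b (iter k T u) u.
Let w k := b (iter k T g) g.

Let Wi k x : W x -> W (iter k T x). Proof. exact: W_iter. Qed.
Let bC x y : W x -> W y -> b x y = b y x.
Proof. by case: hb => _ _ + _; apply. Qed.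

(** Since g = u - T u in the sense of [gu], the covariances are second differences of c. The double
    sum in [stationary_sum_var] therefore telescopes twice. *)
Let wE k : w k = c k - c k.+1 *+ 2 + c k.+2.
Proof.
have cE i z : W z -> b (iter i T z) g = b (iter i T z) u - b (iter i.+1 T z) u.
  move=> Wz; rewrite (bC (Wi i Wz) Wg) (gu (Wi i Wz)) (bC Wu (Wi i Wz)).
  by rewrite (Tsym Wu (Wi i Wz)) (bC Wu (Wi i.+1 Wz)).
have gE i : b (iter i T g) u = c i - c i.+1.
  rewrite (iter_sym WT Tsym i Wg Wu) (gu (Wi i Wu)) /c.
  by rewrite !(iter_sym WT Tsym _ Wu Wu) (Tsym Wu (Wi i Wu)).
by rewrite /w cE// !gE; ring.
Qed.

Lemma stationary_sum_varE n :
  stationary_sum_var w n = n%:R * (c 0%N - c 2%N) - 2 * (c 1%N - c n.+1).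
Proof.
have sw j : \sum_(0 <= k < j) w k.+1 = c 1%N - c 2%N - (c j.+1 - c j.+2).
  elim: j => [|j IH]; first by rewrite big_nil subrr.
  by rewrite big_nat_recr//= IH wE; ring.
rewrite /stationary_sum_var; elim: n => [|n IH].
  by rewrite big_nil mul0r subrr mulr0 subrr.
by rewrite big_nat_recr//= IH sw wE -natr1; ring.
Qed.

Let c_le k : `|c k| <= c 0%N.
Proof.
have := normr_b_le hb (Wi k Wu) Wu; move/le_trans; apply.
rewrite -[c 0%N](sqr_bnorm hb Wu) expr2 ler_wpM2r ?bnorm_ge0//.
apply: le_trans (bnorm_iter_le hb WT alpha0 Tcontr k Wu) _.
by rewrite ler_piMl ?bnorm_ge0// exprn_ile1// ltW.
Qed.

(** For n + 1 terms, right side minus left side is n (c_0 - 2 c_1 + c_2) + (c_0 + c_2 - 2 c_(n+2)).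
    The first bracket is |g|^2, the second is nonnegative since c_(n+2) <= c_2 <= c_0. *)
Lemma stationary_sum_var_le n : stationary_sum_var w n <= 2 * n%:R * (c 0%N - c 1%N).
Proof.
case: n => [|n].
  by rewrite /stationary_sum_var big_nil mulr0 mul0r.
rewrite stationary_sum_varE -natr1.
(* T^(n+2) is split as b(T^n (T u), T u), so that |T u|^2 = c_2 is the bound. *)
have h2 : c n.+2 <= c 2%N.
  have c2E : b (T u) (T u) = c 2%N by rewrite -(Tsym (WT Wu) Wu).
  have -> : c n.+2 = b (iter n T (T u)) (T u).
    by rewrite /c iterS (Tsym (Wi n.+1 Wu) Wu) iterSr.
  apply: le_trans (ler_norm _) _.
  apply: le_trans (normr_b_le hb (Wi n (WT Wu)) (WT Wu)) _.
  rewrite -c2E -(sqr_bnorm hb (WT Wu)) expr2 ler_wpM2r ?bnorm_ge0//.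
  apply: le_trans (bnorm_iter_le hb WT alpha0 Tcontr n (WT Wu)) _.
  by rewrite ler_piMl ?bnorm_ge0// exprn_ile1// ltW.
have h20 : c 2%N <= c 0%N by apply: le_trans (ler_norm _) (c_le 2).
have h : 0 <= c 0%N - c 1%N *+ 2 + c 2%N.
  by rewrite -wE; case: hb => _ _ _; apply.
have : 0 <= n%:R * (c 0%N - c 1%N *+ 2 + c 2%N) by rewrite mulr_ge0.
lra.
Qed.

Lemma cvg_stationary_sum_var :
  (fun n => n%:R^-1 * stationary_sum_var w n) @ \oo --> c 0%N - c 2%N.
Proof.
have inv0 : (fun n : nat => n%:R^-1 : R) @ \oo --> (0 : R).
  apply/gtr0_cvgV0; last exact: cvgr_idn.
  by near=> n; rewrite ltr0n; near: n; exists 1%N.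
have r0 : (fun n : nat => n%:R^-1 * (2 * (c 1%N - c n.+1))) @ \oo --> (0 : R).
  apply: (@squeeze_cvgr _ _ _ _ (fun n => - (n%:R^-1 * (4 * c 0%N)))
      (fun n => n%:R^-1 * (4 * c 0%N))).
  - apply: nearW => n; rewrite -ler_norml normrM.
    rewrite ger0_norm ?invr_ge0 ?ler0n// ler_wpM2l ?invr_ge0 ?ler0n//.
    rewrite normrM ger0_norm//.
    have := ler_normB (c 1%N) (c n.+1); have := c_le 1; have := c_le n.+1.
    lra.
  - by rewrite -oppr0; apply: cvgN; rewrite -[0](mul0r (4 * c 0%N)); apply: cvgMl.
  - by rewrite -[0](mul0r (4 * c 0%N)); apply: cvgMl.
rewrite -[c 0%N - c 2%N]subr0; apply: cvg_trans (cvgB (cvg_cst _) r0).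
apply: near_eq_cvg; near=> n.
rewrite /= stationary_sum_varE mulrBr mulrA mulVf ?mul1r//.
by rewrite pnatr_eq0 -lt0n; near: n; exists 1%N.
Unshelve. all: by end_near. Qed.

(** (I + T) u is paired with (I - T) u, and the cross terms cancel by symmetry. *)
Lemma b_cross : b (lin 1 (T u) u) g = c 0%N - c 2%N.
Proof.
have [Wl bl _ _] := hb; have WTu := WT Wu.
have Ws : W (lin 1 (T u) u) by exact: Wl.
rewrite (bC Ws Wg) (gu Ws) (bC Wu Ws) (bC WTu Ws) !bl//.
by rewrite (bC Wu WTu) -(Tsym WTu Wu) /c /=; ring.
Qed.

End stationary_variance.

(** * Completeness of L_2 *)

Section hilbert_space.
Context d (D : measurableType d) (R : realType) (pi : probability D R).
Implicit Types f g h : D -> R.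

Definition lincomb (a : R) f g : D -> R := fun x => a * f x + g x.

Lemma semi_inner_L2 : semi_inner pi.-L2 lincomb (inner pi).
Proof.
split.
- by move=> a f g f2 g2; exact: L2_lin.
- by move=> a f g h f2 g2 h2; exact: inner_lin.
- by move=> f g _ _; exact: innerC.
- by move=> f _; exact: inner_ge0.
Qed.

Lemma semi_inner_L20 : semi_inner (L20 pi) lincomb (inner pi).
Proof.
have [l2 ll _ _] := semi_inner_L2; split.
- move=> a f g [f2 f0] [g2 g0]; split; first exact: l2.
  by rewrite mean_lin ?f0 ?g0 ?mulr0 ?addr0//; exact: L2_L1.
- by move=> a f g h [f2 _] [g2 _] [h2 _]; exact: ll.
- by move=> f g _ _; exact: innerC.
- by move=> f _; exact: inner_ge0.
Qed.

Local Notation nrm := (bnorm (inner pi)).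

Lemma bnorm_cst c : nrm (cst c) = `|c|.
Proof.
rewrite /bnorm -sqrtr_sqr; congr Num.sqrt.
by rewrite -[RHS](mean_cst pi); congr mean; apply/funext => x; rewrite -expr2.
Qed.

(** Cauchy-Schwarz against the constant 1, as [pi] has mass 1. *)
Lemma mean_norm_le f : pi.-L2 f -> mean pi (fun x => `|f x|) <= nrm f.
Proof.
move=> f2; have fn2 : pi.-L2 (fun x => `|f x|).
  apply: (le_L2 _ _ f2); last by move=> x; rewrite normr_id.
  by apply: measurableT_comp => //; exact: L2_measurable f2.
rewrite -(inner_cst1 pi); apply: le_trans (ler_norm _) _.
apply: le_trans (normr_b_le semi_inner_L2 fn2 (L2_cst _ 1)) _.
rewrite bnorm_cst normr1 mulr1 /bnorm le_eqVlt; apply/orP; left; apply/eqP.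
congr Num.sqrt; congr mean; apply/funext => x.
by rewrite -!expr2 real_normK ?num_real.
Qed.

Lemma normr_mean_le_bnorm f : pi.-L2 f -> `|mean pi f| <= nrm f.
Proof.
move=> f2; apply: le_trans (mean_norm_le f2).
by apply: normr_mean_le; exact: L2_L1.
Qed.

Lemma psumE (v : nat -> D -> R) n x :
  psum lincomb v n x = \sum_(0 <= k < n) v k x.
Proof.
elim: n => [|n IH]; first by rewrite big_nil /= /lincomb mulN1r addNr.
by rewrite big_nat_recr//= -IH /lincomb mul1r addrC.
Qed.

Section geometric_series.
Variables (v : nat -> D -> R) (c q : R).
Hypotheses (v2 : forall k, pi.-L2 (v k)) (c0 : 0 <= c) (q0 : 0 <= q) (q1 : q < 1)
  (vle : forall k, nrm (v k) <= c * q ^+ k).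

Let S := psum lincomb v.
Let S2 n : pi.-L2 (S n). Proof. exact: (W_psum semi_inner_L2). Qed.
Let SS n : S n.+1 = lincomb 1 (v n) (S n). Proof. by []. Qed.
Let mv k : measurable_fun setT (v k). Proof. exact: L2_measurable (v2 k). Qed.

Let q1' : 0 < 1 - q. Proof. by rewrite subr_gt0. Qed.

(** The factor 1 - q^i is the exact partial geometric sum, which lets the induction on i close; it
    is dropped afterwards. *)
Let bnorm_psumB n i :
  nrm (lincomb (-1) (S n) (S (n + i)%N)) <= c * q ^+ n * (1 - q ^+ i) / (1 - q).
Proof.
elim: i => [|i IH].
  rewrite addn0 expr0 subrr mulr0 mul0r (_ : lincomb _ _ _ = cst 0).
    by rewrite bnorm_cst normr0.
  by apply/funext => x; rewrite /lincomb mulN1r addNr.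
have -> : lincomb (-1) (S n) (S (n + i.+1)%N) =
    lincomb 1 (v (n + i)%N) (lincomb (-1) (S n) (S (n + i)%N)).
  by apply/funext => x; rewrite addnS SS /lincomb; ring.
apply: le_trans (bnorm_lin_le semi_inner_L2 _ _ _) _ => //.
  exact: L2_lin.
rewrite normr1 mul1r; apply: le_trans (lerD (vle _) IH) _.
rewrite le_eqVlt; apply/orP; left; apply/eqP; rewrite exprD exprS.
by field; rewrite gt_eqF.
Qed.

Let bnorm_psumB_le n i :
  nrm (lincomb (-1) (S n) (S (n + i)%N)) <= c * q ^+ n / (1 - q).
Proof.
apply: le_trans (bnorm_psumB n i) _.
rewrite ler_pM2r ?invr_gt0// ler_piMr ?mulr_ge0 ?exprn_ge0//.
by rewrite gerDl oppr_le0 exprn_ge0.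
Qed.

Let sum_mean_norm n : \sum_(0 <= k < n) mean pi (fun x => `|v k x|) <= c / (1 - q).
Proof.
have : \sum_(0 <= k < n) mean pi (fun x => `|v k x|) <= c * (1 - q ^+ n) / (1 - q).
  elim: n => [|n IH]; first by rewrite big_nil expr0 subrr mulr0 mul0r.
  rewrite big_nat_recr//=; apply: le_trans (lerD IH (mean_norm_le (v2 n))) _.
  apply: le_trans (lerD (lexx _) (vle n)) _.
  rewrite le_eqVlt; apply/orP; left; apply/eqP; rewrite exprS.
  by field; rewrite gt_eqF.
move/le_trans; apply; rewrite ler_pM2r ?invr_gt0// ler_piMr//.
by rewrite gerDl oppr_le0 exprn_ge0.
Qed.

Let sum_norm_fin : \forall x \ae pi,
  (\sum_(0 <= k <oo) `|v k x|%:E \is a fin_num)%E.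
Proof.
have mn k : measurable_fun setT (fun x => `|v k x|%:E).
  by apply/measurable_EFinP; exact: measurableT_comp.
have ms : measurable_fun setT (fun x => \sum_(0 <= k <oo) `|v k x|%:E)%E.
  by apply: ge0_emeasurable_sum => // k x _ _; rewrite lee_fin.
have : pi.-integrable setT (fun x => \sum_(0 <= k <oo) `|v k x|%:E)%E.
  apply/integrableP; split=> //.
  under eq_integral do rewrite gee0_abs ?nneseries_ge0//.
  rewrite integral_nneseries//.
  apply: (@le_lt_trans _ _ (c / (1 - q))%:E); last exact: ltry.
  apply: lime_le.
    by apply: is_cvg_nneseries => k _ _; apply: integral_ge0 => x _; rewrite lee_fin.
  apply: nearW => n.
  apply: (@le_trans _ _ (\sum_(0 <= k < n) mean pi (fun x => `|v k x|))%:E);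
    last by rewrite lee_fin.
  rewrite -sumEFin; apply: lee_sum => k _.
  by rewrite EFin_mean//; apply/L1_norm/L2_L1.
by move=> /(integrable_ae measurableT); apply: filterS => x /= /(_ I).
Qed.

(** Riesz-Fischer: summable L_2 norms, hence summable L_1 norms, give almost everywhere convergence;
    Fatou's lemma applied to (S_(n+i) - S_n)^2 as i grows bounds the tail. *)
Lemma L2_geometric_series : exists2 s, pi.-L2 s &
  forall n, nrm (lincomb (-1) (S n) s) <= c * q ^+ n / (1 - q).
Proof.
(* The two series of nonnegative terms exist everywhere in the extended reals and are measurable;
   [fine] sends +oo to 0, which affects a null set only. *)
pose sp x := fine (\sum_(0 <= k <oo) ((v k)^\+ x)%:E)%E.
pose sn x := fine (\sum_(0 <= k <oo) ((v k)^\- x)%:E)%E.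
pose s x := sp x - sn x.
have ms : measurable_fun setT s.
  apply: measurable_funB; apply: (@measurableT_comp _ _ _ _ _ _ fine) => //;
    apply: ge0_emeasurable_sum => k //.
  - by move=> x _ _; rewrite lee_fin.
  - by move=> _; apply/measurable_EFinP; exact: measurable_funrpos.
  - by move=> x _ _; rewrite lee_fin.
  - by move=> _; apply/measurable_EFinP; exact: measurable_funrneg.
have Ss : \forall x \ae pi, S n x @[n --> \oo] --> s x.
  apply: filterS sum_norm_fin => x fx.
  have part (f : nat -> R) : (forall k, 0 <= f k) -> (forall k, f k <= `|v k x|) ->
      (\sum_(0 <= k < n) f k)%R @[n --> \oo] --> fine (\sum_(0 <= k <oo) (f k)%:E)%E.
    move=> f0 fv.
    have ffin : (\sum_(0 <= k <oo) (f k)%:E \is a fin_num)%E.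
      rewrite ge0_fin_numE; last by apply: nneseries_ge0 => k _ _; rewrite lee_fin.
      apply: le_lt_trans (_ : \sum_(0 <= k <oo) `|v k x|%:E < +oo)%E.
        by apply: lee_nneseries => k; rewrite lee_fin.
      by rewrite -ge0_fin_numE//; apply: nneseries_ge0 => k _ _; rewrite lee_fin.
    have : (\sum_(0 <= k < n) (f k)%:E)%E @[n --> \oo] -->
        (fine (\sum_(0 <= k <oo) (f k)%:E)%E)%:E.
      by rewrite fineK//; apply: is_cvg_nneseries => k _ _; rewrite lee_fin.
    by move/fine_cvg; apply: cvg_trans; apply: near_eq_cvg; apply: nearW => n /=;
      rewrite sumEFin.
  have cp := part (fun k => (v k)^\+ x) (fun k => funrpos_ge0 _ _) (fun k => _).
  have cn := part (fun k => (v k)^\- x) (fun k => funrneg_ge0 _ _) (fun k => _).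
  apply: cvg_trans (cvgB (cp _) (cn _)).
  - apply: near_eq_cvg; apply: nearW => n; rewrite /S psumE.
    rewrite fctE /= -sumrB.
    by apply: eq_bigr => k _; rewrite -[in RHS](funrposBneg (v k)).
  - by move=> k; have := le_funrpos_norm (v k) x; rewrite ger0_norm.
  - by move=> k; have := le_funrneg_norm (v k) x; rewrite ger0_norm.
have bound n : (\int[pi]_x ((lincomb (-1) (S n) s x) ^+ 2)%:E <=
    ((c * q ^+ n / (1 - q)) ^+ 2)%:E)%E.
  have mS m : measurable_fun setT (S m) by exact: L2_measurable (S2 m).
  pose F i x := ((lincomb (-1) (S n) (S (n + i)%N) x) ^+ 2)%:E.
  have mF i : measurable_fun setT (F i).
    apply/measurable_EFinP; apply: measurable_funX.
    by apply: L2_measurable; exact: L2_lin.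
  have FB i : (\int[pi]_x F i x <= ((c * q ^+ n / (1 - q)) ^+ 2)%:E)%E.
    have SS2 : pi.-L2 (lincomb (-1) (S n) (S (n + i)%N)) by exact: L2_lin.
    have := bnorm_psumB_le n i; rewrite (bnorm_le semi_inner_L2)//; last first.
      by rewrite divr_ge0 ?mulr_ge0 ?exprn_ge0// ltW.
    rewrite -lee_fin EFin_mean; last exact: L2_mul.
    by under eq_integral do rewrite -expr2.
  (* The lower limit is measurable without any convergence and agrees with (s - S_n)^2 almost
     everywhere. *)
  apply: (@le_trans _ _ (\int[pi]_x limn_einf (F ^~ x))%E).
    apply: ae_ge0_le_integral => //.
    - by move=> x _; rewrite lee_fin sqr_ge0.
    - apply/measurable_EFinP; apply: measurable_funX.
      by apply: measurable_funD => //; exact: measurable_funM.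
    - move=> x _; rewrite limn_einf_lim; apply: lime_ge; first exact: is_cvg_einfs.
      by apply: nearW => i; apply: le_ereal_inf_tmp => _ [j _ <-]; rewrite lee_fin sqr_ge0.
    - apply: (emeasurable_fun_cvg (fun i x => einfs (F ^~ x) i)).
        by move=> i; exact: measurable_fun_einfs.
      by move=> x _; rewrite limn_einf_lim; exact: is_cvg_einfs.
    - apply: filterS Ss => x Ssx _.
      have cF : F i x @[i --> \oo] --> ((lincomb (-1) (S n) s x) ^+ 2)%:E.
        have c1 : S (n + i)%N x @[i --> \oo] --> s x.
          move: Ssx; rewrite -(cvg_shiftn n); apply: cvg_trans.
          by apply: near_eq_cvg; apply: nearW => i; rewrite /= addnC.
        apply: cvg_EFin; first exact: nearW.
        have c2 : lincomb (-1) (S n) (S (n + i)%N) x @[i --> \oo] -->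
            lincomb (-1) (S n) s x by apply: cvgD => //; exact: cvg_cst.
        rewrite expr2; apply: cvg_trans (cvgM c2 c2); apply: near_eq_cvg.
        by apply: nearW => i; rewrite !fctE /= -expr2.
      rewrite is_cvg_limn_einfE; last by apply/cvg_ex; eexists; exact: cF.
      by rewrite (cvg_lim _ cF).
  apply: le_trans (fatou _ measurableT mF _) _.
    by move=> i x _; rewrite lee_fin sqr_ge0.
  rewrite limn_einf_lim; apply: lime_le; first exact: is_cvg_einfs.
  by apply: nearW => i; apply: le_trans (FB i); apply: ereal_inf_lbound; exists i => /=.
have sint n : pi.-L2 (lincomb (-1) (S n) s).
  have mS m : measurable_fun setT (S m) by exact: L2_measurable (S2 m).
  have ml : measurable_fun setT (lincomb (-1) (S n) s).
    by apply: measurable_funD => //; exact: measurable_funM.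
  apply/L2P; split=> //; apply/integrableP; split.
    by apply/measurable_EFinP; exact: measurable_funX.
  apply: le_lt_trans (ltry ((c * q ^+ n / (1 - q)) ^+ 2)).
  apply: le_trans (bound n); rewrite le_eqVlt; apply/orP; left; apply/eqP.
  by apply: eq_integral => x _; rewrite gee0_abs// lee_fin sqr_ge0.
exists s => [|n].
  have -> : s = lincomb 1 (S 0%N) (lincomb (-1) (S 0%N) s).
    by apply/funext => x; rewrite /lincomb; ring.
  exact: L2_lin.
rewrite (bnorm_le semi_inner_L2)//; last first.
  by rewrite divr_ge0 ?mulr_ge0 ?exprn_ge0// ltW.
rewrite -lee_fin EFin_mean; last exact: L2_mul.
by under eq_integral do rewrite -expr2; exact: bound.
Qed.

End geometric_series.

(** The limit keeps mean zero: |mean s| is at most the norm of the tail, for every n. *)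
Lemma L20_geometrically_complete :
  geometrically_complete (L20 pi) lincomb (inner pi).
Proof.
move=> v c q Wv c0 q0 q1 vle.
have v2 k : pi.-L2 (v k) by case: (Wv k).
have [s s2 hs] := L2_geometric_series v2 c0 q0 q1 vle.
exists s => //; split => //.
apply: (@eq0_of_geometric_bound _ _ (c / (1 - q)) q) => // n.
have [S2 S0] : L20 pi (psum lincomb v n) by exact: (W_psum semi_inner_L20).
rewrite mulrAC; apply: le_trans (hs n).
apply: le_trans (normr_mean_le_bnorm (L2_lin _ S2 s2)).
by rewrite mean_lin ?S0 ?mulr0 ?add0r//; exact: L2_L1.
Qed.

End hilbert_space.

(** * The transition operator *)

Section transition_operator.
Context (R : realType) d (D : measurableType d) (K : R.-pker D ~> D)
  (pi : probability D R) (hrev : reversible K pi).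
Implicit Types f g h : D -> R.

Local Notation T := (transition_op K).
Local Notation nrm := (bnorm (inner pi)).

Let dominated_K : dominated_kernel pi pi 1 K.
Proof.
split=> [U mU|x|U mU]; first exact: measurable_kernel.
  exact: prob_kernel.
(* Reversibility against the whole space is stationarity, hence the constant 1. *)
rewrite mul1e (hrev mU measurableT).
by under eq_integral do rewrite prob_kernel; rewrite integral_cst// mul1e.
Qed.

(** Point masses average to the identity, so that a plain function also counts as an average. *)
Let dominated_dirac : dominated_kernel pi pi 1 (fun x => \d_x : {measure set D -> \bar R}).
Proof.
split=> [U mU|x|U mU]; first exact: measurable_fun_dirac.
  exact: diracT.
rewrite mul1e (eq_integral (fun x => (\1_U x)%:E))//.
by rewrite integral_indic// setIT.
Qed.

Lemma average_dirac d1 (S : measurableType d1) (X : S -> D) h :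
  measurable_fun setT h -> average (fun x => \d_(X x)) h = h \o X.
Proof.
move=> mh; apply/funext => x; rewrite /average /Rintegral integral_dirac//.
  by rewrite diracT mul1e.
exact/measurable_EFinP.
Qed.

Lemma transition_L1 h : pi.-L1 h -> pi.-L1 (T h).
Proof. exact: (average_L1 dominated_K). Qed.

Lemma transition_L2 h : pi.-L2 h -> pi.-L2 (T h).
Proof. exact: (average_L2 dominated_K). Qed.

Lemma mean_transition h : pi.-L1 h -> mean pi (T h) = mean pi h.
Proof.
move=> h1; rewrite (eq_mean_average dominated_K dominated_dirac)//.
  by rewrite (average_dirac id)//; exact: L1_measurable h1.
move=> U mU; rewrite (hrev mU measurableT).
under eq_integral do rewrite prob_kernel.
rewrite [RHS](eq_integral (fun x => (\1_U x)%:E))//.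
by rewrite integral_cst// mul1e integral_indic// setIT.
Qed.

(** On sets this is the definition of reversibility, with a point mass in place of the indicator. *)
Lemma inner_transition f g : pi.-L2 f -> pi.-L2 g ->
  inner pi (T f) g = inner pi f (T g).
Proof.
move=> f2 g2.
have mf := L2_measurable f2; have mg := L2_measurable g2.
pose delta x : {measure set D -> \bar R} := \d_x.
rewrite (_ : inner pi (T f) g = inner pi (average K f) (average delta g)); last first.
  by rewrite (average_dirac id mg).
rewrite (_ : inner pi f (T g) = inner pi (average delta f) (average K g)); last first.
  by rewrite (average_dirac id mf).
apply: (eq_inner_average dominated_K dominated_dirac dominated_dirac
  dominated_K) => // A B mA mB.
have E U V : measurable U -> measurable V ->
    (\int[pi]_x (\d_x U * K x V) = \int[pi]_(x in U) K x V)%E.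
  move=> mU mV; rewrite [RHS]integral_mkcond; apply: eq_integral => x _.
  by rewrite patchE diracE; case: ifPn => _; rewrite ?mul1e ?mul0e.
under eq_integral do rewrite muleC.
by rewrite !E//; apply: hrev.
Qed.

Lemma transition_lin a f g : pi.-L1 f -> pi.-L1 g ->
  T (fun x => a * f x + g x) = (fun x => a * T f x + T g x) %[ae pi].
Proof. exact: (average_lin dominated_K). Qed.

Lemma mean_norm_transition_le h : pi.-L1 h ->
  mean pi (fun x => `|T h x|) <= mean pi (fun x => `|h x|).
Proof.
move=> h1; have hn1 := L1_norm h1.
rewrite -(mean_transition hn1) -lee_fin.
rewrite (EFin_mean (L1_norm (transition_L1 h1))) (EFin_mean (transition_L1 hn1)).
apply: ae_ge0_le_integral => //.
- by apply/measurable_EFinP; apply: L1_measurable; exact/L1_norm/transition_L1.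
- by move=> x _; rewrite lee_fin; apply: Rintegral_ge0.
- by apply/measurable_EFinP; apply: L1_measurable; exact: transition_L1.
- by apply: filterS (le_normr_average dominated_K h1) => x hx _; rewrite lee_fin.
Qed.

(** [T] acts on functions; it respects almost everywhere equality because it is an L_1 contraction,
    so that null functions have null images. *)
Lemma ae_eq_transition f g : pi.-L1 f -> pi.-L1 g -> f = g %[ae pi] ->
  T f = T g %[ae pi].
Proof.
move=> f1 g1 fg.
have e1 : pi.-L1 (fun x => -1 * f x + g x) by exact: L1_lin.
have T0 : T (fun x => -1 * f x + g x) = cst 0 %[ae pi].
  apply: mean_norm_eq0; first exact: transition_L1.
  apply/eqP; rewrite eq_le mean_ge0 ?andbT// ; apply: le_trans (mean_norm_transition_le e1) _.
  rewrite (ae_eq_mean (g := cst 0)) ?mean_cst//; [exact: L1_norm|exact: L1_cst|].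
  by apply: filterS fg => x /= /[apply] ->; rewrite mulN1r addNr normr0.
apply: filterS2 (transition_lin (-1) f1 g1) T0 => x /(_ I) -> /(_ I) + _.
by rewrite mulN1r addrC => /eqP; rewrite subr_eq0 => /eqP.
Qed.

Lemma sqr_inner_transition_le h : pi.-L2 h ->
  inner pi (T h) (T h) <= inner pi h h.
Proof.
move=> h2; have [_ hh] := (L2P pi h).1 h2.
have Th2 := transition_L2 h2.
have -> : inner pi h h = mean pi (T (fun x => h x ^+ 2)).
  by rewrite mean_transition//; congr mean; apply/funext => x; rewrite expr2.
rewrite -[inner _ _ _]/(mean pi (fun x => T h x * T h x)) -lee_fin.
rewrite (EFin_mean (L2_mul Th2 Th2)) (EFin_mean (transition_L1 hh)).
apply: ae_ge0_le_integral => //.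
- by move=> x _; rewrite lee_fin -expr2 sqr_ge0.
- by apply/measurable_EFinP; exact: L1_measurable (L2_mul Th2 Th2).
- by move=> x _; rewrite lee_fin; apply: Rintegral_ge0 => y _; exact: sqr_ge0.
- by apply/measurable_EFinP; apply: L1_measurable; exact: transition_L1.
- by apply: filterS (sqr_average_le dominated_K h2) => x hx _; rewrite lee_fin -expr2.
Qed.

Lemma transition_L20 h : L20 pi h -> L20 pi (T h).
Proof.
move=> [h2 h0]; split; first exact: transition_L2.
by rewrite mean_transition//; exact: L2_L1.
Qed.

Lemma iter_transition_L1 n h : pi.-L1 h -> pi.-L1 (iter n T h).
Proof. by move=> h1; elim: n => // n; exact: transition_L1. Qed.

Lemma mean_iter_transition n h : pi.-L1 h -> mean pi (iter n T h) = mean pi h.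
Proof.
move=> h1; elim: n => // n IH; rewrite /= mean_transition//.
exact: iter_transition_L1.
Qed.

Lemma iter_transition_scale n a h : pi.-L1 h ->
  iter n T (fun x => a * h x) = (fun x => a * iter n T h x) %[ae pi].
Proof.
move=> h1; have scale f : pi.-L1 f -> pi.-L1 (fun x => a * f x).
  move=> f1; have := L1_lin a f1 (L1_cst pi 0).
  by apply: eq_integrable => // x _; rewrite /= addr0.
elim: n => [|n IH]; first exact: aeW.
have hn1 := iter_transition_L1 n h1.
have e1 := ae_eq_transition (iter_transition_L1 n (scale _ h1)) (scale _ hn1) IH.
(* The multiple a h is written (a - 1) h + h to fit [transition_lin]. *)
have e2 := transition_lin (a - 1) hn1 hn1.
apply: filterS2 e1 e2 => x /= + + _ => /(_ I) -> /(_ I).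
move=> E.
rewrite (_ : (fun y => a * iter n T h y) =
  (fun y => (a - 1) * iter n T h y + iter n T h y)) ?E; first by ring.
by apply/funext => y; ring.
Qed.

Context (alpha M : R) (alpha0 : 0 <= alpha) (alpha1 : alpha < 1).
Hypothesis hconv : L1_exp_convergent K pi alpha M.

(** [opnorm] is a supremum over the unit ball, so h enters through its multiple by a, with a the
    inverse of its L_1 norm. *)
Lemma L1_convergence n h : (0 < n)%N -> pi.-L1 h ->
  mean pi (fun x => `|iter n T h x - mean pi h|) <=
  M * alpha ^+ n * mean pi (fun x => `|h x|).
Proof.
move=> n0 h1.
have key a : 0 <= a -> a * mean pi (fun x => `|h x|) <= 1 ->
    a * mean pi (fun x => `|iter n T h x - mean pi h|) <= M * alpha ^+ n.
  move=> a0 ha.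
  have ah1 : pi.-L1 (fun x => a * h x).
    have := L1_lin a h1 (L1_cst pi 0).
    by apply: eq_integrable => // x _; rewrite /= addr0.
  have meanZ f : pi.-L1 f -> mean pi (fun x => a * f x) = a * mean pi f.
    by move=> f1; rewrite /mean RintegralZl.
  have I1 : pi.-L1 (fun x => iter n T h x - mean pi h).
    have := L1_lin 1 (iter_transition_L1 n h1) (L1_cst pi (- mean pi h)).
    by apply: eq_integrable => // x _; rewrite /= mul1r.
  have aI1 : pi.-L1 (fun x => iter n T (fun x => a * h x) x - mean pi (fun x => a * h x)).
    have := L1_lin 1 (iter_transition_L1 n ah1) (L1_cst pi (- mean pi (fun x => a * h x))).
    by apply: eq_integrable => // x _; rewrite /= mul1r.
  rewrite -lee_fin; apply: le_trans (hconv n0).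
  apply: ereal_sup_ge.
  eexists; first (exists (fun x => a * h x); [split|reflexivity]).
  - exact/Lfun1_integrable.
  - rewrite Lnorm1_mean// lee_fin; apply: le_trans ha.
    rewrite -meanZ; last exact: L1_norm.
    rewrite le_eqVlt; apply/orP; left; apply/eqP; congr mean.
    by apply/funext => x; rewrite normrM ger0_norm.
  - rewrite Lnorm1_mean// lee_fin -meanZ; last exact: L1_norm.
    rewrite le_eqVlt; apply/orP; left; apply/eqP; apply: ae_eq_mean.
    + have := L1_lin a (L1_norm I1) (L1_cst pi 0).
      by apply: eq_integrable => // x _; rewrite /= addr0.
    + exact: L1_norm.
    apply: filterS (iter_transition_scale n a h1) => x /= /[apply] ->.
    by rewrite meanZ// -mulrBr normrM (ger0_norm a0).
have [h0|h0] := eqVneq (mean pi (fun x => `|h x|)) 0.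
  rewrite h0 mulr0 leNgt; apply/negP => y0.
  set y := mean _ _ in y0 key.
  (* h is null, so every a >= 0 is admissible; this one makes the left side |M alpha^n| + 1, beyond
     the bound. *)
  have := key ((`|M * alpha ^+ n| + 1) / y).
  have a0 : 0 <= (`|M * alpha ^+ n| + 1) / y.
    by apply: divr_ge0; [exact: addr_ge0|exact: ltW].
  rewrite h0 mulr0 ler01 => /(_ a0 isT).
  rewrite mulfVK ?gt_eqF//; have := ler_norm (M * alpha ^+ n); lra.
have hp : 0 < mean pi (fun x => `|h x|).
  by rewrite lt_neqAle eq_sym h0 mean_ge0.
have := key (mean pi (fun x => `|h x|))^-1.
rewrite invr_ge0 (ltW hp) mulVf// lexx => /(_ isT isT).
by rewrite mulrC ler_pdivrMr.
Qed.

End transition_operator.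

(** * Contraction on L_2^0 and the spectral bound Lambda *)

Section contraction_on_L20.
Context (R : realType) d (D : measurableType d) (K : R.-pker D ~> D)
  (pi : probability D R) (hrev : reversible K pi).
Context (alpha M : R) (alpha0 : 0 <= alpha) (alpha1 : alpha < 1).
Hypothesis hconv : L1_exp_convergent K pi alpha M.
Implicit Types f g h : D -> R.

Local Notation T := (transition_op K).
Local Notation nrm := (bnorm (inner pi)).
Local Notation hb := (semi_inner_L20 pi).

Let WT h : L20 pi h -> L20 pi (T h). Proof. exact: transition_L20. Qed.
Let Tsym f g : L20 pi f -> L20 pi g -> inner pi (T f) g = inner pi f (T g).
Proof. by move=> [f2 _] [g2 _]; exact: inner_transition. Qed.

Lemma bounded_transition_contraction h B : L20 pi h -> (forall x, `|h x| <= B) ->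
  inner pi (T h) (T h) <= alpha ^+ 2 * inner pi h h.
Proof.
move=> h20 hB; have [h2 h0] := h20; have h1 := L2_L1 h2.
apply: (contraction_of_decay hb WT Tsym
  (c := B * (M * mean pi (fun x => `|h x|)))) => // n n0.
rewrite (b_iter WT Tsym)//.
have nn0 : (0 < n + n)%N by rewrite addn_gt0 n0.
have := L1_convergence hrev hconv nn0 h1; rewrite h0.
under [in X in X -> _]eq_fun do rewrite subr0.
have Th1 := iter_transition_L1 hrev (n + n) h1.
have Th2 : pi.-L2 (iter (n + n) T h) by case: (W_iter WT (n + n) h20).
have B0 : 0 <= B by apply: le_trans (hB point); exact: normr_ge0.
move=> /(ler_wpM2l B0) le1.
apply: (@le_trans _ _ (B * mean pi (fun x => `|iter (n + n) T h x|))); last first.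
  apply: le_trans le1 _; rewrite le_eqVlt; apply/orP; left; apply/eqP.
  by rewrite -exprM mul2n -addnn; ring.
have -> : B * mean pi (fun x => `|iter (n + n) T h x|) =
    mean pi (fun x => B * `|iter (n + n) T h x| + cst 0 x).
  by rewrite mean_lin ?mean_cst ?addr0//; [exact: L1_norm|exact: L1_cst].
apply: le_mean => [||x]; first exact: L2_mul.
  by apply: L1_lin; [exact: L1_norm|exact: L1_cst].
rewrite addr0; apply: le_trans (ler_norm _) _.
by rewrite normrM ler_wpM2r.
Qed.

(** Truncation at height m is close to h by dominated convergence, but no longer centred. Its mean
    is that of the truncation error, so recentring costs no more than e / 2 again. *)
Lemma truncation_approx h (e : R) : L20 pi h -> 0 < e ->
  exists z, [/\ L20 pi z, exists B, forall x, `|z x| <= B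
    & nrm (lincomb (-1) z h) <= e].
Proof.
move=> [h2 h0] e0; have [mh hh] := (L2P pi h).1 h2.
pose hm (m : nat) x := Num.max (- m%:R) (Num.min m%:R (h x)).
have mhm m : measurable_fun setT (hm m).
  by apply: measurable_maxr => //; apply: measurable_minr.
have hmB m x : `|hm m x| <= m%:R.
  rewrite /hm ler_norml le_max lexx /= ge_max ge_min lexx /= ?orbT ?andbT.
  by have : (0 : R) <= m%:R by []; lra.
have hm_le m x : `|h x - hm m x| <= `|h x|.
  rewrite /hm; have m0 : (0 : R) <= m%:R by [].
  have [hxm|/ltW hxm] := leP m%:R (h x).
    by rewrite max_r; [rewrite !ger0_norm; lra|lra].
  have [hx|/ltW hx] := leP (- m%:R) (h x); first by rewrite subrr normr0.
  by rewrite !ler0_norm; lra.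
have hm2 m : pi.-L2 (hm m).
  by apply: (le_L2 _ _ (L2_cst pi m%:R)) => // x; rewrite [leRHS]ger0_norm /=.
have d2 m : pi.-L2 (lincomb (-1) (hm m) h) by exact: L2_lin.
have cv : (fun m => \int[pi]_x ((lincomb (-1) (hm m) h x) ^+ 2)%:E)%E @ \oo --> 0%E.
  have [|||||_ _] := @dominated_convergence _ _ R pi setT measurableT
    (fun m x => ((lincomb (-1) (hm m) h x) ^+ 2)%:E) (cst 0%E) (fun x => (h x ^+ 2)%:E).
  - move=> m; apply/measurable_EFinP; apply: measurable_funX.
    exact: L2_measurable (d2 m).
  - exact: measurable_cst.
  - apply: aeW => x _; apply: cvg_near_cst; near=> m.
    rewrite /lincomb /hm min_r; last first.
      by near: m; exact: nbhs_infty_ger.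
    rewrite max_r; last first.
      rewrite lerNl; near: m; exact: nbhs_infty_ger.
    by rewrite mulN1r addNr expr0n.
  - exact: hh.
  - apply: aeW => x m _; rewrite /= lee_fin ger0_norm ?sqr_ge0//.
    rewrite -[leLHS]real_normK ?num_real// -[leRHS]real_normK ?num_real//.
    by rewrite lerXn2r ?nnegrE// /lincomb mulN1r addrC.
  by rewrite integral_cst// mul0e.
have /fine_cvg /cvgrPdist_le /(_ ((e / 2) ^+ 2)) := cv.
rewrite exprn_gt0 ?divr_gt0// => /(_ isT)[m _ /(_ m (leqnn m))] /=.
rewrite sub0r normrN => hm_e.
have nm : nrm (lincomb (-1) (hm m) h) <= e / 2.
  rewrite (bnorm_le (semi_inner_L2 pi))//; last by rewrite divr_ge0// ltW.
  apply: le_trans hm_e; apply: le_trans (ler_norm _).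
  rewrite le_eqVlt; apply/orP; left; apply/eqP; congr fine.
pose z x := hm m x - mean pi (hm m).
have mz : `|mean pi (hm m)| <= e / 2.
  apply: le_trans nm; apply: le_trans (normr_mean_le_bnorm (d2 m)).
  by rewrite mean_lin ?h0 ?addr0 ?mulN1r ?normrN//; exact: L2_L1.
have zE : z = lincomb 1 (hm m) (cst (- mean pi (hm m))).
  by apply/funext => x; rewrite /lincomb mul1r.
exists z; split.
- split; first by rewrite zE; apply: L2_lin => //; exact: L2_cst.
  rewrite zE mean_lin ?mean_cst ?mul1r ?subrr//; [exact: L2_L1|exact: L1_cst].
- exists (m%:R + `|mean pi (hm m)|) => x.
  by apply: le_trans (ler_normB _ _) _; rewrite lerD2r.
- have -> : lincomb (-1) z h = lincomb 1 (lincomb (-1) (hm m) h) (cst (mean pi (hm m))).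
    by apply/funext => x; rewrite /lincomb /z /=; ring.
  apply: le_trans (bnorm_lin_le (semi_inner_L2 pi) _ _ _) _ => //.
    exact: L2_cst.
  by rewrite normr1 mul1r bnorm_cst; lra.
Unshelve. all: by end_near. Qed.

(** The bounded part z contracts by alpha; the remainder y is only known not to expand, which costs
    2 |y| <= e in total. *)
Lemma transition_contraction h : L20 pi h ->
  inner pi (T h) (T h) <= alpha ^+ 2 * inner pi h h.
Proof.
move=> h20.
rewrite -(sqr_bnorm hb h20) -exprMn -(bnorm_le hb)//; last 2 first.
- exact: WT.
- by rewrite mulr_ge0// bnorm_ge0.
apply/ler_addgt0Pr => e e0.
have e2 : 0 < e / 2 by rewrite divr_gt0.
have [z [z20 [B zB] ze]] := truncation_approx h20 e2.
set y := lincomb (-1) z h in ze.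
have y20 : L20 pi y by case: hb => + _ _ _; apply.
have bl f : L20 pi f -> inner pi (T h) f = inner pi (T z) f + inner pi (T y) f.
  move=> f20; rewrite !Tsym// /y; have [_ bl _ _] := hb.
  by rewrite bl//; [ring|exact: WT].
have Tz : nrm (T z) <= alpha * nrm z.
  rewrite (bnorm_le hb) ?mulr_ge0 ?bnorm_ge0//; last exact: WT.
  rewrite exprMn (sqr_bnorm hb)//.
  exact: bounded_transition_contraction zB.
have Ty : nrm (T y) <= nrm y.
  by apply: ler_wsqrtr; apply: sqr_inner_transition_le => //; case: y20.
have zh : nrm z <= nrm h + nrm y.
  have -> : z = lincomb (-1) y h.
    by apply/funext => x; rewrite /y /lincomb; ring.
  apply: le_trans (bnorm_lin_le hb _ _ _) _ => //.
  by rewrite normrN1 mul1r addrC.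
(* T is additive only almost everywhere; the triangle inequality comes from pairing T h with itself
   and splitting by [bl]. *)
have Th : nrm (T h) <= nrm (T z) + nrm (T y).
  have [->|Th0] := eqVneq (nrm (T h)) 0; first by rewrite addr_ge0 ?bnorm_ge0.
  have Thp : 0 < nrm (T h) by rewrite lt_neqAle eq_sym Th0 bnorm_ge0.
  rewrite -(ler_pM2r Thp) -expr2 (sqr_bnorm hb) ?bl//; try exact: WT.
  rewrite mulrDl; apply: lerD; apply: le_trans (ler_norm _) _;
    apply: (normr_b_le hb); exact: WT.
have az : alpha * nrm z <= alpha * nrm h + nrm y.
  apply: le_trans (ler_wpM2l alpha0 zh) _; rewrite mulrDr lerD2l.
  by rewrite ler_piMl ?bnorm_ge0// ltW.
apply: le_trans Th _; apply: le_trans (lerD Tz Ty) _.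
apply: le_trans (lerD az (lexx _)) _; rewrite -addrA lerD2l.
by apply: le_trans (lerD ze ze) _; rewrite -splitr.
Qed.

Lemma ae_eq_of_inner f g : L20 pi f -> L20 pi g ->
  (forall z, L20 pi z -> inner pi f z = inner pi g z) -> f = g %[ae pi].
Proof.
move=> f20 g20 fg; have [l2 ll _ _] := hb.
have e20 : L20 pi (lincomb (-1) g f) by exact: l2.
have [e2 _] := e20; have := inner_eq0 e2; rewrite ll// fg// mulN1r addNr => /(_ erefl).
apply: filterS => x /[apply]; rewrite /lincomb mulN1r addrC => /eqP.
by rewrite subr_eq0 => /eqP.
Qed.

Lemma scale_sub_transition_L20 a h : L20 pi h ->
  L20 pi (fun x => a * h x - T h x).
Proof.
move=> h20; have [l2 _ _ _] := hb.
have -> : (fun x => a * h x - T h x) =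
    lincomb a h (lincomb (-1) (T h) (lincomb (-1) h h)).
  by apply/funext => x; rewrite /lincomb; ring.
by apply: (l2) => //; apply: (l2); [exact: WT|exact: l2].
Qed.

Lemma inner_scale_sub_transition a h z : L20 pi h -> L20 pi z ->
  inner pi (fun x => a * h x - T h x) z = a * inner pi h z - inner pi (T h) z.
Proof.
move=> h20 z20; have [l2 ll _ _] := hb.
have -> : (fun x => a * h x - T h x) = lincomb a h (lincomb (-1) (T h) (cst 0)).
  by apply/funext => x; rewrite /lincomb /=; ring.
have c0 : L20 pi (cst 0) by split; [exact: L2_cst|rewrite mean_cst].
have i0 : inner pi (cst 0) z = 0.
  by rewrite -[RHS](mean_cst pi 0); congr mean; apply/funext => x; rewrite mul0r.
have T20 := WT h20.
rewrite ll//; last exact: l2.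
by rewrite ll// i0; ring.
Qed.

Lemma bounded_inverse_exists a : alpha < a ->
  exists B, is_bounded_inverse pi (L20 pi) (fun h x => a * h x - T h x) B.
Proof.
move=> aa; have [c c0 hc] := resolvent_exists hb WT Tsym alpha0
  transition_contraction (@L20_geometrically_complete _ _ _ pi) aa.
have a0 : 0 < a by exact: le_lt_trans aa.
(* Outside L_2^0 the value is arbitrary. *)
pose B h := if pselect (L20 pi h) is left h20 then sval (cid (hc h h20)) else h.
have BP h : L20 pi h -> [/\ L20 pi (B h), nrm (B h) <= c * nrm h &
    forall z, L20 pi z -> a * inner pi (B h) z - inner pi (T (B h)) z = inner pi h z].
  by move=> h20; rewrite /B; case: pselect => // ?; case: cid.
exists B; split.
- by move=> h /BP[].
- exists c => h h20; have [[B2 _] Bc _] := BP _ h20.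
  by have [h2 _] := h20; rewrite !Lnorm2_inner// -EFinM lee_fin.
- move=> h h20; have [B20 _ Bz] := BP _ h20.
  apply: ae_eq_of_inner => //; first exact: scale_sub_transition_L20.
  by move=> z z20; rewrite inner_scale_sub_transition// Bz.
- move=> h h20; have A20 := scale_sub_transition_L20 a h20.
  have [B20 _ Bz] := BP _ A20.
  have [l2 ll _ _] := hb; set s := B _ in B20 Bz *.
  (* The error y of the left inverse satisfies a y = T y when tested on L_2^0; since a > alpha, the
     contraction forces y to be null. *)
  pose y := lincomb (-1) h s; have y20 : L20 pi y by exact: l2.
  have yy z : L20 pi z -> a * inner pi y z = inner pi (T y) z.
    move=> z20; have Tz := WT z20.
    have := Bz _ z20; rewrite inner_scale_sub_transition// !Tsym//.
    rewrite /y !ll// => e; lra.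
  have y0 : inner pi y y = 0.
    apply/eqP; rewrite eq_le inner_ge0 andbT.
    have := normr_b_T_le hb WT alpha0 transition_contraction y20.
    rewrite -yy// normrM (gtr0_norm a0) ger0_norm ?inner_ge0// => le_y.
    rewrite -(@pmulr_rle0 _ (a - alpha)) ?subr_gt0//.
    by rewrite mulrBl subr_le0.
  apply: filterS (inner_eq0 (proj1 y20) y0) => x /[apply].
  by rewrite /y /lincomb mulN1r addrC => /eqP; rewrite subr_eq0 => /eqP.
Qed.

Lemma spectrum_ub : ubound (spectrum pi (L20 pi) T) alpha.
Proof. by move=> a; apply: contra_notP => /negP; rewrite -ltNge; exact: bounded_inverse_exists. Qed.

Lemma Lambda_lt1 : Lambda K pi < 1.
Proof.
have [s0|/set0P s0] := eqVneq (spectrum pi (L20 pi) T) set0.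
  by rewrite /Lambda s0 sup0.
by apply: le_lt_trans alpha1; apply: ge_sup => //; exact: spectrum_ub.
Qed.

Lemma inner_transition_le_Lambda h : L20 pi h ->
  inner pi (T h) h <= Lambda K pi * inner pi h h.
Proof.
move=> h20; have [h0|h0] := eqVneq (inner pi h h) 0.
  have := normr_b_T_le hb WT alpha0 transition_contraction h20.
  by rewrite h0 !mulr0; apply: le_trans; exact: ler_norm.
have hp : exists2 x, L20 pi x & 0 < inner pi x x.
  by exists h => //; rewrite lt_neqAle eq_sym h0 inner_ge0.
have [lambda [la lb lc]] := numerical_range_not_bounded_below hb WT Tsym
  alpha0 alpha1 transition_contraction hp.
apply: le_trans (lb _ h20) _; rewrite ler_wpM2r ?inner_ge0//.
have sp : spectrum pi (L20 pi) T lambda.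
  (* An inverse bounded by c gives |x| <= c |lambda x - T x|, which [lc] excludes. *)
  move=> [B [WB [c hc] _ BA]]; apply: lc; exists (c ^+ 2) => x x20.
  have AE : (fun y => lambda * x y - T x y) =
      lincomb lambda x (lincomb (-1) (T x) (lincomb (-1) x x)).
    by apply/funext => y; rewrite /lincomb; ring.
  rewrite -AE; have A20 := scale_sub_transition_L20 lambda x20.
  have [x2 _] := x20; have [A2 _] := A20; have [B2 _] := WB _ A20.
  have Bx : nrm (B (fun y => lambda * x y - T x y)) = nrm x.
    rewrite /bnorm; congr Num.sqrt; have bx := BA _ x20.
    by rewrite (ae_eq_inner B2 x2 B2 bx) innerC (ae_eq_inner B2 x2 x2 bx).
  have := hc _ A20; rewrite !Lnorm2_inner// -EFinM lee_fin -/(nrm _) Bx => nx.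
  rewrite -(sqr_bnorm hb x20) -(sqr_bnorm hb A20) -exprMn.
  by rewrite lerXn2r// nnegrE ?bnorm_ge0// (le_trans _ nx)// bnorm_ge0.
apply: sup_upper_bound => //; split; first by exists lambda.
by exists alpha; exact: spectrum_ub.
Qed.

End contraction_on_L20.

(** * The Markov chain *)

Section chain.
Context (R : realType) d (D : measurableType d) (K : R.-pker D ~> D)
  (pi nu : probability D R) (hrev : reversible K pi)
  (r : R) (r0 : 0 <= r)
  (nu_le : forall U, measurable U -> (nu U <= (1 + r)%:E * pi U)%E)
  (nu_dist : forall h, pi.-L1 h ->
    `|mean nu h - mean pi h| <= r * mean pi (fun x => `|h x|)).
Context d1 (O : measurableType d1) (P : probability O R)
  (X : nat -> {mfun O >-> D}) (hX : markov_chain P X K nu).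
Implicit Types f g h : D -> R.

Local Notation T := (transition_op K).
Local Notation delta n := (fun w : O => \d_(X n w) : {measure set D -> \bar R}).

Let integral_delta n (U : set D) : measurable U ->
  (\int[P]_w (delta n w U) = P (X n @^-1` U))%E.
Proof.
move=> mU; rewrite (eq_integral (fun w => (\1_(X n @^-1` U) w)%:E))//.
by rewrite integral_indic// ?setIT// -[X in measurable X]setTI; exact: measurable_funP.
Qed.

Let deltaT n w : delta n w setT = 1%E. Proof. exact: diracT. Qed.

Let mdelta n (U : set D) : measurable U -> measurable_fun setT (fun w => delta n w U).
Proof.
move=> mU; apply: (@measurableT_comp _ _ _ _ _ _ (fun x => \d_x U)) => //.
exact: measurable_fun_dirac.
Qed.

Let mKX n (U : set D) : measurable U -> measurable_fun setT (fun w => K (X n w) U).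
Proof.
move=> mU; apply: (@measurableT_comp _ _ _ _ _ _ (fun x => K x U)) => //.
exact: measurable_kernel.
Qed.

Lemma history_preimage n i (A : set D) : (1 <= i <= n)%N -> measurable A ->
  history X n (X i @^-1` A).
Proof.
move=> i1n mA; apply: sub_sigma_algebra; exists i => //.
by exists A => //; rewrite setTI.
Qed.

(** The event that [X i] lies in A belongs to the history up to n; integrating the conditional
    probability over it gives the identity. Point masses replace indicators so that
    [eq_inner_average] applies. *)
Lemma markov_step n i (A B : set D) : (1 <= i <= n)%N ->
  measurable A -> measurable B ->
  (\int[P]_w (delta i w A * delta n.+1 w B) = \int[P]_w (delta i w A * K (X n w) B))%E.
Proof.
move=> /andP[i1 iN] mA mB; have n0 : (0 < n)%N by exact: leq_trans iN.
have mXA : measurable (X i @^-1` A) by rewrite -[X in measurable X]setTI; exact: measurable_funP.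
have mXB : measurable (X n.+1 @^-1` B) by rewrite -[X in measurable X]setTI; exact: measurable_funP.
have [_ /(_ n B n0 mB)[_ /(_ (X i @^-1` A))]] := hX.
move=> /(_ (history_preimage _ mA)); rewrite i1 iN => /(_ isT) E.
transitivity (P (X n.+1 @^-1` B `&` X i @^-1` A)).
  rewrite -[X in P X]setIT -integral_indic//; last exact: measurableI.
  apply: eq_integral => w _; rewrite indicI EFinM muleC.
  by congr (_ * _)%E; rewrite /= !indicE.
rewrite -E integral_mkcond; apply: eq_integral => w _.
rewrite patchE /= diracE.
by have -> : (w \in X i @^-1` A) = (X i w \in A) by []; case: ifPn => _; rewrite ?mul1e ?mul0e.
Qed.

Let C0 : 0 <= 1 + r. Proof. by rewrite addr_ge0. Qed.

Lemma integral_next n (U : set D) : (0 < n)%N -> measurable U ->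
  (\int[P]_w (delta n.+1 w U) = \int[P]_w K (X n w) U)%E.
Proof.
move=> n0 mU; have := @markov_step n n setT U; rewrite n0 leqnn => /(_ isT measurableT mU).
under eq_integral do rewrite deltaT mul1e.
by under [X in _ = X -> _]eq_integral do rewrite deltaT mul1e.
Qed.

(** The law of every [X n] is at most (1 + r) pi: this holds for [nu], and one step of the chain
    preserves it because [pi] is stationary. Functions in L_1 or L_2 of [pi] may thus be composed
    with [X n]. *)
Lemma dominated_delta n : (0 < n)%N -> dominated_kernel pi P (1 + r) (delta n).
Proof.
elim: n => // -[_ _|n IH _]; split=> [U mU|x|U mU]; try exact: mdelta;
  try exact: diracT.
  by rewrite integral_delta// hX.1//; exact: nu_le.
rewrite integral_next//.
have mKU : measurable_fun setT (fun x => K x U) by exact: measurable_kernel.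
have KU0 x : (0 <= K x U)%E by exact: measure_ge0.
have := le_integral_dominated_kernel (IH isT) mKU KU0.
have -> : (\int[pi]_x K x U = pi U)%E.
  rewrite (hrev mU measurableT).
  by under eq_integral do rewrite prob_kernel; rewrite integral_cst// mul1e.
apply: le_trans; rewrite le_eqVlt; apply/orP; left; apply/eqP.
by apply: eq_integral => w _; rewrite integral_dirac// deltaT mul1e.
Qed.

Lemma dominated_KX n : (0 < n)%N ->
  dominated_kernel pi P (1 + r) (fun w => K (X n w)).
Proof.
move=> n0; split=> [U mU|x|U mU]; first exact: mKX.
  exact: prob_kernel.
by rewrite -integral_next//; have [_ _] := @dominated_delta n.+1 isT; apply.
Qed.

Lemma L2_chain n h : (0 < n)%N -> pi.-L2 h -> P.-L2 (h \o X n).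
Proof.
move=> n0 h2; rewrite -(average_dirac (X n) (L2_measurable h2)).
exact: (average_L2 (dominated_delta n0)).
Qed.

Lemma dominated_nu : dominated_kernel pi nu (1 + r) (fun x => \d_x : {measure set D -> \bar R}).
Proof.
split=> [U mU|x|U mU]; [exact: measurable_fun_dirac|exact: diracT|].
rewrite (eq_integral (fun x => (\1_U x)%:E))//.
by rewrite integral_indic// setIT; exact: nu_le.
Qed.

Lemma L1_nu h : pi.-L1 h -> nu.-L1 h.
Proof.
move=> h1; have := average_L1 dominated_nu h1.
by rewrite (average_dirac id (L1_measurable h1)).
Qed.

Lemma mean_chain n h : pi.-L1 h -> mean P (h \o X n.+1) = mean nu (iter n T h).
Proof.
elim: n h => [|n IH] h h1; have mh := L1_measurable h1.
  rewrite -(average_dirac (X 1%N) mh).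
  transitivity (mean nu (average (fun x => \d_x : {measure set D -> \bar R}) h)); last first.
    by rewrite (average_dirac id mh).
  apply: (eq_mean_average (dominated_delta (isT : (0 < 1)%N)) dominated_nu) => // U mU.
  rewrite integral_delta// hX.1// [RHS](eq_integral (fun x => (\1_U x)%:E))//.
  by rewrite integral_indic// setIT.
rewrite iterSr -IH; last exact: transition_L1.
rewrite -(average_dirac (X n.+2) mh).
rewrite (eq_mean_average (dominated_delta (isT : (0 < n.+2)%N))
  (dominated_KX (isT : (0 < n.+1)%N)))// => U mU.
exact: integral_next.
Qed.

Lemma inner_chain_step n i f h : (1 <= i <= n)%N -> pi.-L2 f -> pi.-L2 h ->
  inner P (f \o X i) (h \o X n.+1) = inner P (f \o X i) (T h \o X n).
Proof.
move=> /[dup] /andP[i1 iN] i1n f2 h2.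
rewrite -(average_dirac (X i) (L2_measurable f2)).
rewrite -(average_dirac (X n.+1) (L2_measurable h2)).
have n0 : (0 < n)%N by exact: leq_trans iN.
apply: (eq_inner_average (dominated_delta i1) (dominated_delta (isT : (0 < n.+1)%N))
  (dominated_delta i1) (dominated_KX n0)) => // A B mA mB.
exact: markov_step.
Qed.

(** The Markov property moves k steps from [X (i + k)%N] into P^k h; what is left is a function of
    [X i] alone. The exponent is i - 1 because the chain starts with [X 1%N]. *)
Lemma inner_chain i k f h : (0 < i)%N -> pi.-L2 f -> pi.-L2 h ->
  inner P (f \o X i) (h \o X (i + k)%N) =
  mean nu (iter i.-1 T (fun x => f x * iter k T h x)).
Proof.
move=> i0 f2; elim: k h => [|k IH] h h2; last first.
  rewrite addnS inner_chain_step ?i0 ?leq_addr// IH//; last exact: transition_L2.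
  by rewrite iterSr.
rewrite addn0 -mean_chain; last exact: L2_mul.
by rewrite prednK.
Qed.

Context (alpha M : R) (alpha0 : 0 <= alpha) (alpha1 : alpha < 1).
Hypothesis hconv : L1_exp_convergent K pi alpha M.
Variable n0 : nat.
Hypothesis M1 : n0 = 0%N -> 1 <= M.

(** M is a real of unspecified sign; for m >= 1 the convergence bound, tested on the constant 1,
    dominates a nonnegative number. *)
Lemma Malpha_ge0 m : (n0 <= m)%N -> 0 <= M * alpha ^+ m.
Proof.
case: m => [|m] n0m.
  by rewrite expr0 mulr1 (le_trans ler01)// M1//; apply/eqP; rewrite -leqn0.
have := L1_convergence hrev hconv (isT : (0 < m.+1)%N) (L1_cst pi 1).
have -> : mean pi (fun x => `|cst 1 x|) = 1.
  by rewrite -[RHS](mean_cst pi); congr mean; apply/funext => x; rewrite normr1.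
by rewrite mulr1; apply: le_trans; exact: mean_ge0.
Qed.

Lemma mean_iter_nu_le m h : (n0 <= m)%N -> pi.-L1 h ->
  `|mean nu (iter m T h) - mean pi h| <=
  r * (M * alpha ^+ m) * mean pi (fun x => `|h x|).
Proof.
move=> n0m h1; have Th1 := iter_transition_L1 hrev m h1.
case: m n0m Th1 => [|m] n0m Th1.
  (* P^0 is not covered by [hconv]; here 1 <= M takes over. *)
  rewrite expr0 mulr1 /=; apply: le_trans (nu_dist h1) _.
  rewrite ler_wpM2r ?mean_ge0// ler_peMr//.
  by apply: M1; apply/eqP; rewrite -leqn0.
(* [nu_dist] is applied to P^m h - S(h), whose L_1 norm decays, and not to h; its [pi]-mean is 0. *)
pose e x := 1 * iter m.+1 T h x + cst (- mean pi h) x.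
have e1 : pi.-L1 e by apply: L1_lin => //; exact: L1_cst.
have me (m' : probability D R) : m'.-L1 (iter m.+1 T h) ->
    mean m' e = mean m' (iter m.+1 T h) - mean pi h.
  by move=> i1; rewrite mean_lin ?mean_cst ?mul1r//; exact: L1_cst.
have -> : mean nu (iter m.+1 T h) - mean pi h = mean nu e - mean pi e.
  rewrite (me _ Th1) (me _ (L1_nu Th1)) (mean_iter_transition hrev m.+1 h1).
  by rewrite subrr subr0.
apply: le_trans (nu_dist e1) _; rewrite -mulrA ler_wpM2l//.
apply: le_trans _ (L1_convergence hrev hconv (isT : (0 < m.+1)%N) h1).
by rewrite le_eqVlt; apply/orP; left; apply/eqP; congr mean; apply/funext => x;
  rewrite /e mul1r.
Qed.

Local Notation nrm := (bnorm (inner pi)).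

(** alpha^i is the decay since the start, acting on the product g P^k g; a further alpha^k comes
    from the L_1 norm of this product, at most |g| |P^k g| <= alpha^k |g|^2. *)
Lemma inner_chain_le i k g : (n0 <= i)%N -> L20 pi g ->
  `|inner P (g \o X i.+1) (g \o X (i.+1 + k)%N) - inner pi (iter k T g) g| <=
  r * M * inner pi g g * alpha ^+ (i + k).
Proof.
move=> n0i g20; have [g2 _] := g20.
have hb := semi_inner_L20 pi.
have WT := transition_L20 hrev.
have Tc := transition_contraction hrev alpha0 alpha1 hconv.
have Tk20 : L20 pi (iter k T g) by exact: (W_iter WT).
have [Tk2 _] := Tk20.
rewrite inner_chain// innerC.
apply: le_trans (mean_iter_nu_le n0i (L2_mul g2 Tk2)) _.
have gk : mean pi (fun x => `|g x * iter k T g x|) <= alpha ^+ k * inner pi g g.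
  have nL2 f : pi.-L2 f -> pi.-L2 (fun x => `|f x|).
    move=> f2; apply: (le_L2 _ _ f2); last by move=> x; rewrite normr_id.
    by apply: measurableT_comp => //; exact: L2_measurable f2.
  have nn f : nrm (fun x => `|f x|) = nrm f.
    congr Num.sqrt; congr mean; apply/funext => x.
    by rewrite -!expr2 real_normK ?num_real.
  rewrite (_ : mean _ _ = inner pi (fun x => `|g x|) (fun x => `|iter k T g x|)); last first.
    by congr mean; apply/funext => x; rewrite normrM.
  apply: le_trans (ler_norm _) _.
  apply: le_trans (normr_b_le (semi_inner_L2 pi) (nL2 _ g2) (nL2 _ Tk2)) _.
  rewrite !nn -(sqr_bnorm hb g20) expr2 mulrA mulrC ler_wpM2r ?bnorm_ge0//.
  exact: (bnorm_iter_le hb WT alpha0 Tc).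
apply: le_trans (ler_wpM2l _ gk) _; first by rewrite mulr_ge0 ?Malpha_ge0.
by rewrite le_eqVlt; apply/orP; left; apply/eqP; rewrite exprD; ring.
Qed.

(** The full series is (1 + alpha) / (1 - alpha)^2, and 1 + alpha <= 2 yields the constant. *)
Lemma sum_geometric_linear_le n :
  \sum_(0 <= j < n) alpha ^+ j * (1 + 2 * j%:R) <= 2 / (1 - alpha) ^+ 2.
Proof.
have a1 : 0 < 1 - alpha by rewrite subr_gt0.
rewrite ler_pdivlMr ?exprn_gt0//.
have -> : (\sum_(0 <= j < n) alpha ^+ j * (1 + 2 * j%:R)) * (1 - alpha) ^+ 2 =
    1 + alpha - alpha ^+ n * (1 + alpha + 2 * n%:R * (1 - alpha)).
  elim: n => [|n IH]; first by rewrite big_nil expr0; ring.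
  by rewrite big_nat_recr//= mulrDl IH (exprS alpha n) -(natr1 n); ring.
have : 0 <= alpha ^+ n * (1 + alpha + 2 * n%:R * (1 - alpha)).
  rewrite mulr_ge0 ?exprn_ge0// !addr_ge0// !mulr_ge0//; exact: ltW.
lra.
Qed.

(** The summand of index m brings one variance and, counted twice, m covariances with earlier
    summands, each off by at most B alpha^m, where B includes alpha^n0; hence the weights 1 + 2 j of
    the preceding sum. *)
Lemma chain_sum_var_le n g : L20 pi g ->
  `|mean P (fun w => (\sum_(0 <= j < n) g (X (j + n0).+1 w)) ^+ 2)
    - stationary_sum_var (fun k => inner pi (iter k T g) g) n| <=
  r * M * inner pi g g * alpha ^+ n0 * (2 / (1 - alpha) ^+ 2).
Proof.
move=> g20; have [g2 _] := g20.
set B := r * M * inner pi g g * alpha ^+ n0.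
have B0 : 0 <= B.
  have -> : B = r * (M * alpha ^+ n0) * inner pi g g by rewrite /B; ring.
  by apply: mulr_ge0; [apply: mulr_ge0 => //; exact: Malpha_ge0|exact: inner_ge0].
pose G j := g \o X (j + n0).+1.
have G2 j : P.-L2 (G j) by apply: L2_chain.
pose S n w := \sum_(0 <= j < n) G j w.
have S2 m : P.-L2 (S m).
  elim: m => [|m IH].
    rewrite (_ : S 0%N = cst 0); first exact: L2_cst.
    by apply/funext => w; rewrite /S big_nil.
  rewrite (_ : S m.+1 = lincomb 1 (S m) (G m)); first exact: L2_lin.
  by apply/funext => w; rewrite /S big_nat_recr//= /lincomb mul1r.
set w := fun k => inner pi (iter k T g) g.
have main m : `|inner P (S m) (S m) - stationary_sum_var w m| <=
    B * \sum_(0 <= j < m) alpha ^+ j * (1 + 2 * j%:R).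
  elim: m => [|m IH].
    rewrite /stationary_sum_var !big_nil mulr0 subr0 (_ : inner _ _ _ = 0) ?normr0//.
    by rewrite -[RHS](mean_cst P); congr mean; apply/funext => x; rewrite /S big_nil mul0r.
  have SS : S m.+1 = lincomb 1 (S m) (G m).
    by apply/funext => x; rewrite /S big_nat_recr//= /lincomb mul1r.
  have [_ bl _ _] := semi_inner_L2 P; have blr := semi_inner_linr (semi_inner_L2 P).
  have SG : inner P (S m) (G m) = \sum_(0 <= i < m) inner P (G i) (G m).
    have E k : inner P (S k) (G m) = \sum_(0 <= i < k) inner P (G i) (G m).
      elim: k => [|k IHk].
        rewrite big_nil -[RHS](mean_cst P); congr mean.
        by apply/funext => x; rewrite /S big_nil mul0r.
      rewrite big_nat_recr//= -IHk (_ : S k.+1 = lincomb 1 (S k) (G k)) ?bl ?mul1r//.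
      by apply/funext => x; rewrite /S big_nat_recr//= /lincomb mul1r.
    exact: E.
  (* [stationary_sum_var] sums over the lag, the expansion of the square over the earlier index. *)
  have sumw : \sum_(0 <= k < m) w k.+1 = \sum_(0 <= i < m) w (m - i)%N.
    rewrite [RHS]big_nat_rev /=; apply: eq_big_nat => i /andP[_ im].
    by rewrite add0n subKn.
  have cross i : (i <= m)%N -> `|inner P (G i) (G m) - w (m - i)%N| <= B * alpha ^+ m.
    move=> im; have n0i : (n0 <= i + n0)%N by rewrite leq_addl.
    have := inner_chain_le (m - i) n0i g20.
    rewrite /G addSn -addnA (addnC n0) addnA subnKC//.
    move/le_trans; apply; rewrite le_eqVlt; apply/orP; left; apply/eqP.
    by rewrite /B exprD; ring.
  have -> : inner P (S m.+1) (S m.+1) =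
      inner P (S m) (S m) + inner P (G m) (G m) + 2 * \sum_(0 <= i < m) inner P (G i) (G m).
    rewrite SS bl//; last exact: L2_lin.
    rewrite !blr// -SG (innerC _ (G m) (S m)); ring.
  have cross_sum : `|\sum_(0 <= i < m) inner P (G i) (G m) - \sum_(0 <= k < m) w k.+1| <=
      m%:R * (B * alpha ^+ m).
    rewrite sumw -sumrB; apply: le_trans (ler_norm_sum _ _ _) _.
    rewrite mulr_natl -[X in _ *+ X](subn0 m) -sumr_const_nat.
    rewrite !big_nat; apply: ler_sum => i /andP[_ im]; apply: cross; exact: ltnW.
  have c0 := cross m (leqnn m); rewrite subnn in c0.
  rewrite /stationary_sum_var !big_nat_recr//= -/(stationary_sum_var w m).
  move: IH c0 cross_sum; rewrite mulrDr.
  move: (inner P (S m) (S m)) (inner P (G m) (G m)) (stationary_sum_var w m)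
    (\sum_(0 <= i < m) inner P (G i) (G m)) (\sum_(0 <= k < m) w k.+1) => A C v x y.
  move: (B * \sum_(0 <= i < m) _) => b IH c0 xy.
  rewrite (_ : A + C + 2 * x - _ = (A - v) + (C - w 0%N) + 2 * (x - y)); last by ring.
  rewrite (_ : b + _ = b + B * alpha ^+ m + 2 * (m%:R * (B * alpha ^+ m))); last by ring.
  apply: le_trans (ler_normD _ _) _; apply: lerD; last by rewrite normrM ger0_norm// ler_pM2l.
  by apply: le_trans (ler_normD _ _) _; exact: lerD.
have -> : mean P (fun x => (\sum_(0 <= j < n) g (X (j + n0).+1 x)) ^+ 2) = inner P (S n) (S n).
  by congr mean; apply/funext => x; rewrite expr2.
by apply: le_trans (main n) _; rewrite ler_wpM2l// sum_geometric_linear_le.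
Qed.

End chain.

(** * Initial distributions with bounded density *)

Section initial_distribution.
Context (R : realType) d (D : measurableType d) (pi nu : probability D R).
Hypothesis hnu : M_infty pi nu.
Implicit Types h : D -> R.

Let rho := density nu pi.

Let dom : nu `<< pi. Proof. by case: hnu. Qed.

Let rho_int : pi.-integrable setT rho. Proof. exact: Radon_Nikodym_integrable. Qed.

Let rho_fin x : rho x \is a fin_num. Proof. exact: Radon_Nikodym_fin_num. Qed.

Let piT : (0 < pi setT)%E.
Proof. by rewrite [X in (_ < X)%E]probability_setT. Qed.

Lemma LnormyB1_fin_num : ('N[pi]_+oo[rho \- cst 1] \is a fin_num)%E.
Proof.
rewrite ge0_fin_numE ?Lnorm_ge0//.
have [_] := hnu; rewrite unlock piT => rhoy.
have rhof : ess_sup pi (abse \o rho) \is a fin_num.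
  rewrite ge0_fin_numE//; apply: ess_sup_gee; [exact: piT|by apply: aeW => x /=].
apply: (@le_lt_trans _ _ (ess_sup pi (abse \o rho) + 1)%E); last first.
  by rewrite -(fineK rhof) -EFinD ltry.
apply/ess_supP; apply: filterS (ess_sup_ge pi (abse \o rho)) => x hx.
apply: le_trans (lee_abs_sub _ _) _.
by rewrite leeD//= normr1.
Qed.

Let r := fine 'N[pi]_+oo[rho \- cst 1]%E.

Lemma density_dist_le : \forall x \ae pi, `|fine (rho x) - 1| <= r.
Proof.
have := ess_sup_ge pi (abse \o (rho \- cst 1))%E; apply: filterS => x hx.
rewrite -lee_fin /r fineK ?LnormyB1_fin_num// unlock piT.
apply: le_trans hx; rewrite /= -abse_EFin EFinB fineK//.
Qed.

Lemma density_dist_ge0 : 0 <= r. Proof. by rewrite fine_ge0// Lnorm_ge0. Qed.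

Lemma nu_le_pi (U : set D) : measurable U -> (nu U <= (1 + r)%:E * pi U)%E.
Proof.
move=> mU; have mrho : measurable_fun U rho.
  by apply: measurable_funTS; exact: measurable_int rho_int.
have nuU : (nu U = \int[pi]_(x in U) rho x)%E.
  exact: (@Radon_Nikodym_integral _ _ _ (charge_of_finite_measure nu) pi U dom mU).
rewrite nuU -integral_cst//; apply: (@le_trans _ _ (\int[pi]_(x in U) `|rho x|)%E).
  by rewrite -nuU -[leLHS]gee0_abs// nuU; exact: le_abse_integral.
apply: ae_ge0_le_integral => //.
- exact: measurableT_comp.
- by move=> x _; rewrite lee_fin addr_ge0// density_dist_ge0.
apply: filterS density_dist_le => x hx _.
rewrite -(fineK (rho_fin x)) lee_fin.
by rewrite -[X in `|X|](subrK 1) (le_trans (ler_normD _ _))// normr1 addrC lerD2l.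
Qed.

(** The difference of the means is the integral of h (rho - 1) against [pi]. *)
Lemma mean_nu_dist h : pi.-L1 h ->
  `|mean nu h - mean pi h| <= r * mean pi (fun x => `|h x|).
Proof.
move=> h1; have h1nu : nu.-L1 h.
  exact: (L1_nu nu_le_pi).
have mh := L1_measurable h1.
have mrho : measurable_fun setT (fun x => fine (rho x)).
  apply: (@measurableT_comp _ _ _ _ _ _ fine) => //; exact: measurable_int rho_int.
have hrho : pi.-L1 (fun x => h x * (fine (rho x) - 1)).
  have rh1 : pi.-L1 (fun x => r * `|h x|).
    have := L1_lin r (L1_norm h1) (L1_cst pi 0).
    by apply: eq_integrable => // x _; rewrite /= addr0.
  apply/integrableP; split.
    by apply/measurable_EFinP; apply: measurable_funM => //; exact: measurable_funB.
  have /integrableP[mrh] := rh1; apply: le_lt_trans.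
  apply: ae_ge0_le_integral => //.
  - apply: measurableT_comp => //; apply/measurable_EFinP.
    by apply: measurable_funM => //; exact: measurable_funB.
  - exact: measurableT_comp mrh.
  apply: filterS density_dist_le => x hx _ /=.
  rewrite lee_fin normrM [leRHS]normrM normr_id mulrC ler_wpM2r//.
  by rewrite [leRHS]ger0_norm ?density_dist_ge0.
have nuE : mean nu h = mean pi (fun x => 1 * h x + h x * (fine (rho x) - 1)).
  rewrite /mean /Rintegral; congr fine.
  rewrite -(Radon_Nikodym_change_of_variables dom measurableT h1nu).
  apply: eq_integral => x _; rewrite -[X in (_ * X)%E](fineK (rho_fin x)) -EFinM.
  by congr EFin; ring.
rewrite nuE mean_lin// mul1r [X in X - _]addrC addrK.
apply: le_trans (normr_mean_le hrho) _.
rewrite -lee_fin (EFin_mean (L1_norm hrho)) EFinM (EFin_mean (L1_norm h1)).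
rewrite -integralZl//; last exact: L1_norm.
apply: ae_ge0_le_integral => //.
- by apply/measurable_EFinP; exact: L1_measurable (L1_norm hrho).
- by move=> x _; rewrite lee_fin mulr_ge0// density_dist_ge0.
- by apply: measurable_funeM; apply/measurable_EFinP; exact: L1_measurable (L1_norm h1).
apply: filterS density_dist_le => x hx _.
by rewrite -EFinM lee_fin normrM mulrC ler_wpM2r.
Qed.

End initial_distribution.

(** * The squared error as the second moment of a centred sum *)

Section mean_square_error.
Context (R : realType) d (D : measurableType d) (pi : probability D R)
  d1 (O : measurableType d1) (P : probability O R) (X : nat -> {mfun O >-> D}).

(** [mc_error] is a power 1/2 in the extended reals; squaring undoes it once the expectation is
    identified as a nonnegative real. The indices 1..n become 0..n-1, whence the successor in
    [(j + n0).+1]. *)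
Lemma mc_error_sqr n n0 (f g : D -> R) : (0 < n)%N ->
  (forall x, g x = f x - mean pi f) -> (forall j, (0 < j)%N -> P.-L2 (g \o X j)) ->
  (mc_error P X pi n n0 f ^+ 2 = (n%:R ^- 2 *
    mean P (fun w => (\sum_(0 <= j < n) g (X (j + n0).+1 w)) ^+ 2))%:E)%E.
Proof.
move=> n1 gE g2.
have S2 : P.-L2 (fun w => \sum_(0 <= j < n) g (X (j + n0).+1 w)).
  elim: n {n1} => [|m IH].
    under [X in X \in _]eq_fun do rewrite big_nil.
    exact: L2_cst.
  under [X in X \in _]eq_fun do rewrite big_nat_recr//= -[X in X + _]mul1r.
  by apply: L2_lin => //; exact: (g2 (m + n0).+1).
have SS : P.-L1 (fun w => (\sum_(0 <= j < n) g (X (j + n0).+1 w)) ^+ 2).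
  by have [] := (L2P P _).1 S2.
have E : ('E_P[fun w => (`|sample_mean X n n0 f w - mean pi f| ^+ 2)%R] =
  (n%:R ^- 2 * mean P (fun w => (\sum_(0 <= j < n) g (X (j + n0).+1 w)) ^+ 2))%:E)%E.
  rewrite EFinM (EFin_mean SS) -integralZl//; rewrite unlock.
  apply: eq_integral => w _; rewrite -EFinM; congr EFin.
  rewrite real_normK ?num_real// /sample_mean big_add1/=.
  have n0' : (n%:R : R) != 0 by rewrite pnatr_eq0 -lt0n.
  have -> : \sum_(0 <= j < n) g (X (j + n0).+1 w) =
      \sum_(0 <= j < n) f (X (j.+1 + n0)%N w) - n%:R * mean pi f.
    under eq_bigr do rewrite gE.
    by rewrite sumrB sumr_const_nat subn0 mulr_natl.
  by field.
rewrite /mc_error E poweR_EFin -EFin_expe powR12_sqrt ?sqr_sqrtr//;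
  by rewrite mulr_ge0 ?invr_ge0 ?sqr_ge0 ?exprn_ge0//; apply: mean_ge0 => w; exact: sqr_ge0.
Qed.

End mean_square_error.

(** * Mean square error *)

Section mean_square_error_bounds.
Context (R : realType) d (D : measurableType d) (K : R.-pker D ~> D)
  (pi : probability D R) (hrev : reversible K pi).
Context (alpha M : R) (alpha0 : 0 <= alpha) (alpha1 : alpha < 1).
Hypothesis hconv : L1_exp_convergent K pi alpha M.
Context (f : D -> R) (f2 : pi.-L2 f).

Local Notation T := (transition_op K).
Let g x := f x - mean pi f.

Lemma L20_centered : L20 pi g.
Proof.
have -> : g = lincomb 1 f (cst (- mean pi f)).
  by apply/funext => x; rewrite /lincomb mul1r.
split; first by apply: L2_lin => //; exact: L2_cst.
by rewrite mean_lin ?mean_cst ?mul1r ?subrr//; [exact: L2_L1|exact: L1_cst].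
Qed.

(** Centring subtracts the square of the mean: |g|^2 = |f|^2 - S(f)^2. *)
Lemma inner_centered_le : inner pi g g <= inner pi f f.
Proof.
have -> : g = lincomb 1 f (cst (- mean pi f)).
  by apply/funext => x; rewrite /lincomb mul1r.
have c2 : pi.-L2 (cst (- mean pi f)) by exact: L2_cst.
have [l2 ll _ _] := semi_inner_L2 pi; have llr := semi_inner_linr (semi_inner_L2 pi).
have fc h : pi.-L2 h -> inner pi h (cst (- mean pi f)) = - mean pi f * mean pi h.
  move=> h2; rewrite (_ : cst _ = lincomb (- mean pi f - 1) (cst 1) (cst 1)).
    by rewrite llr ?inner_cst1//; [ring|exact: L2_cst|exact: L2_cst].
  by apply/funext => x; rewrite /lincomb /=; ring.
rewrite ll//; last exact: l2.
rewrite !llr// (innerC _ (cst _) f) !fc// mean_cst.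
have := sqr_ge0 (mean pi f); lra.
Qed.

Variable u : D -> R.
Hypotheses (Wu : L20 pi u) (ug : (fun x => u x - T u x) = g %[ae pi]).

Let WT h : L20 pi h -> L20 pi (T h). Proof. exact: transition_L20. Qed.
Let Tsym h k : L20 pi h -> L20 pi k -> inner pi (T h) k = inner pi h (T k).
Proof. by move=> [h2 _] [k2 _]; exact: inner_transition. Qed.
Let Tcontr h : L20 pi h -> inner pi (T h) (T h) <= alpha ^+ 2 * inner pi h h.
Proof. exact: (transition_contraction hrev alpha0 alpha1 hconv). Qed.
Let hb := semi_inner_L20 pi.
Let Wg := L20_centered.

Let gu z : L20 pi z -> inner pi g z = inner pi u z - inner pi (T u) z.
Proof.
move=> z20; rewrite -[inner pi u z]mul1r -(inner_scale_sub_transition hrev)//.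
have [A2 _] := scale_sub_transition_L20 hrev 1 Wu.
have [z2 _] := z20; have [g2 _] := Wg.
apply/esym/ae_eq_inner => //.
by apply: filterS ug => x /[apply]; rewrite mul1r.
Qed.

Let w k := inner pi (iter k T g) g.

Lemma centered_sum_var_le n : stationary_sum_var w n <=
  2 * n%:R / (1 - Lambda K pi) * inner pi f f.
Proof.
have L1 : 0 < 1 - Lambda K pi.
  by rewrite subr_gt0; exact: (Lambda_lt1 hrev alpha0 alpha1 hconv).
apply: le_trans (stationary_sum_var_le hb WT Tsym alpha0 alpha1 Tcontr Wu Wg gu n) _.
rewrite -[leRHS]mulrA ler_wpM2l//= ler_pdivlMl//.
apply: le_trans inner_centered_le.
have := gap_inequality hb WT Wu (Lambda_lt1 hrev alpha0 alpha1 hconv)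
  (inner_transition_le_Lambda hrev alpha0 alpha1 hconv).
move/le_trans; apply.
have [l2 ll _ _] := hb; have Tu := WT Wu.
(* [gap_inequality] concerns u - T u itself, to which g is equal only almost everywhere; the two are
   compared through inner products. *)
set g' := lincomb (-1) (T u) u; have Wg' : L20 pi g' by exact: l2.
have gg z : L20 pi z -> inner pi g' z = inner pi g z.
  by move=> Wz; rewrite ll// gu//; ring.
by rewrite gg// innerC gg.
Qed.

Section one_chain.
Context (nu : probability D R) (r : R) (r0 : 0 <= r)
  (nu_le : forall U, measurable U -> (nu U <= (1 + r)%:E * pi U)%E)
  (nu_dist : forall h, pi.-L1 h ->
    `|mean nu h - mean pi h| <= r * mean pi (fun x => `|h x|)).
Context d1 (O : measurableType d1) (P : probability O R)
  (X : nat -> {mfun O >-> D}) (hX : markov_chain P X K nu) (n0 : nat).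

Let A n := mean P (fun x => (\sum_(0 <= j < n) g (X (j + n0).+1 x)) ^+ 2).

Let mc_errorE n : (0 < n)%N ->
  (mc_error P X pi n n0 f ^+ 2 = (n%:R ^- 2 * A n)%:E)%E.
Proof.
move=> n_gt0; apply: mc_error_sqr => // j j0.
have [g2 _] := Wg. exact: (L2_chain hrev nu_le hX j0 g2).
Qed.

Lemma mc_error_le n : (n0 = 0%N -> 1 <= M) -> (0 < n)%N ->
  (mc_error P X pi n n0 f ^+ 2 <=
    (2 / (n%:R * (1 - Lambda K pi)) * inner pi f f +
     2 * M * r * (alpha ^+ n0 / (n%:R ^+ 2 * (1 - alpha) ^+ 2)) * inner pi f f)%:E)%E.
Proof.
move=> M1 n_gt0; rewrite mc_errorE// lee_fin.
have n0' : (0 : R) < n%:R by rewrite ltr0n.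
have L1 : 1 - Lambda K pi != 0.
  by rewrite gt_eqF// subr_gt0; exact: (Lambda_lt1 hrev alpha0 alpha1 hconv).
have a1 : 0 < (1 - alpha) ^+ 2 by rewrite exprn_gt0// subr_gt0.
rewrite ler_pdivrMl ?exprn_gt0//.
have := chain_sum_var_le hrev r0 nu_le nu_dist hX alpha0 alpha1 hconv M1 n Wg.
rewrite ler_norml => /andP[_]; rewrite lerBlDl => /le_trans; apply.
rewrite mulrDr; apply: lerD.
  apply: le_trans (centered_sum_var_le n) _.
  by rewrite le_eqVlt; apply/orP; left; apply/eqP; field; rewrite L1 gt_eqF.
have -> : n%:R ^+ 2 *
    (2 * M * r * (alpha ^+ n0 / (n%:R ^+ 2 * (1 - alpha) ^+ 2)) * inner pi f f) =
    (2 / (1 - alpha) ^+ 2 * r * (M * alpha ^+ n0)) * inner pi f f.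
  by field; rewrite (gt_eqF n0') subr_eq0 eq_sym lt_eqF.
have -> : r * M * inner pi g g * alpha ^+ n0 * (2 / (1 - alpha) ^+ 2) =
    (2 / (1 - alpha) ^+ 2 * r * (M * alpha ^+ n0)) * inner pi g g by ring.
apply: ler_wpM2l inner_centered_le.
apply: mulr_ge0; last exact: (Malpha_ge0 hrev hconv M1).
by rewrite mulr_ge0// divr_ge0// ltW.
Qed.

Lemma cvg_mc_error :
  (n%:R%:E * mc_error P X pi n n0 f ^+ 2)%E @[n --> \oo] -->
  (inner pi (fun x => u x + T u x) g)%:E.
Proof.
(* Any bound independent of n suffices here; with max(M, 1) the condition for n0 = 0 holds
   automatically. *)
have hconv' : L1_exp_convergent K pi alpha (Num.max M 1).
  move=> n n_gt0; apply: le_trans (hconv n_gt0) _.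
  by rewrite lee_fin ler_wpM2r ?exprn_ge0// le_max lexx.
pose C := r * Num.max M 1 * inner pi g g * alpha ^+ n0 * (2 / (1 - alpha) ^+ 2).
have dist n : `|A n - stationary_sum_var w n| <= C.
  apply: (chain_sum_var_le hrev r0 nu_le nu_dist hX alpha0 alpha1 hconv') => // _.
  by rewrite le_max lexx orbT.
have inv0 : (fun n : nat => n%:R^-1 : R) @ \oo --> (0 : R).
  apply/gtr0_cvgV0; last exact: cvgr_idn.
  by near=> n; rewrite ltr0n; near: n; exists 1%N.
have diff0 : (fun n : nat => n%:R^-1 * (A n - stationary_sum_var w n)) @ \oo --> (0 : R).
  apply: (@squeeze_cvgr _ _ _ _ (fun n => - (n%:R^-1 * C)) (fun n => n%:R^-1 * C)).
  - apply: nearW => n; rewrite -ler_norml normrM.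
    by rewrite ger0_norm ?invr_ge0 ?ler0n// ler_wpM2l ?invr_ge0 ?ler0n.
  - by rewrite -oppr0; apply: cvgN; rewrite -[0](mul0r C); apply: cvgMl.
  - by rewrite -[0](mul0r C); apply: cvgMl.
have := cvg_stationary_sum_var hb WT Tsym alpha0 alpha1 Tcontr Wu Wg gu.
rewrite -(b_cross hb WT Tsym Wu Wg gu) => cvV.
have -> : (fun x => u x + T u x) = lincomb 1 (T u) u.
  by apply/funext => x; rewrite /lincomb mul1r addrC.
have cvA : (fun n : nat => n%:R^-1 * A n) @ \oo --> inner pi (lincomb 1 (T u) u) g.
  rewrite -[inner _ _ _]addr0; apply: cvg_trans (cvgD cvV diff0).
  by apply: near_eq_cvg; apply: nearW => n; rewrite fctE /=; ring.
apply: (@cvg_trans _ ((n%:R^-1 * A n)%:E @[n --> \oo])).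
  apply: near_eq_cvg; near=> n.
  have n_gt0 : (0 < n)%N by near: n; exists 1%N.
  rewrite mc_errorE// -EFinM; congr EFin; field.
  by rewrite pnatr_eq0 -lt0n.
apply: cvg_EFin; first exact: nearW.
exact: cvA.
Unshelve. all: by end_near. Qed.

End one_chain.
End mean_square_error_bounds.

Theorem theorem3p34 (R : realType) (d : measure_display) (D : measurableType d)
    (K : R.-pker D ~> D) (pi nu : probability D R) (alpha M : R)
    (d1 : measure_display) (O : measurableType d1) (P : probability O R)
    (X : nat -> {mfun O >-> D}) (n0 : nat) (f : D -> R)
    (hX : markov_chain P X K nu)
    (hrev : reversible K pi)
    (halpha0 : 0 <= alpha) (halpha1 : alpha < 1)
    (hconv : L1_exp_convergent K pi alpha M)
    (hf : f \in Lfun pi 2%:E)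
    (hnu : M_infty pi nu) :
  (* without [1 <= M] the estimate fails for n0 = 0, e.g. for M = alpha = 0 and
     K x = pi *)
  ((n0 = 0%N -> 1 <= M) -> forall n : nat, (0 < n)%N ->
    (mc_error P X pi n n0 f ^+ 2 <=
      (2 / (n%:R * (1 - Lambda K pi)))%:E * 'N[pi]_2%:E[EFin \o f] ^+ 2
      + (2 * M)%:E * 'N[pi]_+oo[density nu pi \- cst 1]
          * (alpha ^+ n0 / (n%:R ^+ 2 * (1 - alpha) ^+ 2))%:E
          * 'N[pi]_2%:E[EFin \o f] ^+ 2)%E) /\
  (let g : D -> R := fun x => f x - mean pi f in
   (* Q is the inverse of I - P on L_2^0 *)
   exists2 Q : (D -> R) -> (D -> R),
     is_bounded_inverse pi (L20 pi) (fun h x => h x - transition_op K h x) Q &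
     let l : R := inner pi (fun x => Q g x + transition_op K (Q g) x) g in
     ((n%:R%:E * mc_error P X pi n n0 f ^+ 2)%E @[n --> \oo] --> l%:E) /\
     (forall (d2 : measure_display) (O' : measurableType d2)
        (P' : probability O' R) (Y : nat -> {mfun O' >-> D}),
        markov_chain P' Y K pi ->
        (n%:R%:E * mc_error P' Y pi n 0 f ^+ 2)%E @[n --> \oo] --> l%:E)).
Proof.
have [r0 nule nud] := And3 (density_dist_ge0 pi nu) (@nu_le_pi _ _ _ _ _ hnu) (@mean_nu_dist _ _ _ _ _ hnu).
(* The value a = 1 exceeds alpha, which makes I - P invertible on L_2^0. *)
have [B hB] := bounded_inverse_exists hrev halpha0 halpha1 hconv halpha1.
have {}hB : is_bounded_inverse pi (L20 pi) (fun h x => h x - transition_op K h x) B.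
  move: hB; congr (is_bounded_inverse _ _ _ _).
  by apply/funext => h; apply/funext => x; rewrite mul1r.
have Wg := L20_centered hf.
have [BW _ AB _] := hB; have Wu := BW _ Wg; have ug := AB _ Wg.
split=> [M1 n n_gt0|g].
  rewrite Lnorm2_sqr// -(fineK (LnormyB1_fin_num hnu)) -!EFinM -EFinD.
  exact: (mc_error_le hrev halpha0 halpha1 hconv hf Wu ug r0 nule nud hX).
exists B => // l; split.
  exact: (cvg_mc_error hrev halpha0 halpha1 hconv hf Wu ug r0 nule nud hX).
move=> d2 O' P' Y hY.
(* The stationary chain is the case [nu] = [pi], r = 0, n0 = 0 of the same limit. *)
apply: (cvg_mc_error hrev halpha0 halpha1 hconv hf Wu ug (lexx 0) _ _ hY).
  by move=> U mU; rewrite addr0 mul1e.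
by move=> h h1; rewrite subrr normr0 mul0r.
Qed.
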